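(* Let $p$ be an odd prime, $n\ge1$, and let $F$ be a field with $\operatorname{char}(F)\ne p$ and $\mu_p\not\subseteq F$. Suppose $p\nmid[F(\mu_{p^n}):F]$. Let $D$ be a (central) division algebra of degree $p^n$ over $F$. Then $D$ is a cyclic algebra over $F$ if and only if there is a $\gamma\in D$ with $\gamma^{p^n}\in F^*-F^{*p}$.
   Context: $\mu_k$ denotes the group of $k$-th roots of unity in an algebraic closure of $F$. A central division algebra $D$ over $F$ has degree $d$ if $\dim_FD=d^2$. A cyclic algebra of degree $m$ over $F$ is an algebra of the form $(C/F,\sigma,b)=\bigoplus_{i=0}^{m-1}Cx^i$, where $C$ is a cyclic Galois field extension of $F$ of degree $m$, $\mathrm{Gal}(C/F)=\langle\sigma\rangle$, $b\in F^*$, $x^m=b$, and $xcx^{-1}=\sigma(c)$ for $c\in C$. *)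

(* Defs.v *)
From HB Require Import structures.
From mathcomp Require Import all_boot all_order all_algebra all_fingroup.
From mathcomp Require Import all_solvable all_field.

Set Implicit Arguments.
Unset Strict Implicit.
Unset Printing Implicit Defensive.

Import GRing.Theory.
Local Open Scope ring_scope.

Section SubfieldsOfOverfield.

Variables (F : fieldType) (K : fieldType) (iota : {rmorphism F -> K}).

Definition subfield_over (E : K -> Prop) : Prop :=
  [/\ forall a : F, E (iota a),
      forall x y, E x -> E y -> E (x - y),
      forall x y, E x -> E y -> E (x * y)
    & forall x, E x -> E x^-1].

Definition adjoin (S : K -> Prop) (z : K) : Prop :=
  forall E : K -> Prop, subfield_over E -> (forall x, S x -> E x) -> E z.

(* [E : F] = d, where a finite extension E of F inside K is presented as the
   image of an F-embedding of some L : fieldExtType F. *)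
Definition degree_over (E : K -> Prop) (d : nat) : Prop :=
  exists (L : fieldExtType F) (j : {rmorphism L -> K}),
    [/\ forall a : F, j a%:A = iota a,
        forall z : K, E z <-> exists x : L, z = j x
      & \dim {:L} = d].

End SubfieldsOfOverfield.

Definition is_algebraic_closure (F : fieldType) (K : closedFieldType)
    (iota : {rmorphism F -> K}) : Prop :=
  forall z : K, algebraicOver iota z.

Definition mu (K : fieldType) (k : nat) (z : K) : Prop := z ^+ k = 1.

Definition is_central_division (F : fieldType) (D : falgType F) : Prop :=
  ('Z({:D}) = 1)%VS /\ (forall x : D, x != 0 -> x \is a GRing.unit).

Definition has_degree (F : fieldType) (D : falgType F) (d : nat) : Prop :=
  \dim {:D} = (d ^ 2)%N.

(* D is isomorphic to (C/F, sigma, b): h embeds C in D over F, and D is the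
   direct sum of the h(C) x^i for i < m = [C : F].  A Galois extension C of F
   is always a splittingFieldType F, so that type loses no generality. *)
Definition is_cyclic_algebra (F : fieldType) (D : falgType F) : Prop :=
  exists (C : splittingFieldType F) (sigma : gal_of {:C}) (b : F)
         (h : {lrmorphism C -> D}) (x : D),
    let m := \dim {:C} in
    [/\ galois 1 {:C} /\ 'Gal({:C} / 1)%g = <[sigma]>%g,
        b != 0,
        x ^+ m = b%:A,
        forall c : C, x * h c * x^-1 = h (sigma c)
      & bijective (fun c : {ffun 'I_m -> C} => \sum_(i < m) h (c i) * x ^+ i)].

(* Main.v *)
Require Import Defs.
From HB Require Import structures.
From mathcomp Require Import all_boot all_order all_algebra all_fingroup.
From mathcomp Require Import all_solvable all_field.
From mathcomp Require Import zify.

Set Implicit Arguments.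
Unset Strict Implicit.
Unset Printing Implicit Defensive.

Import GRing.Theory.
Local Open Scope ring_scope.

(* Let q = p^n.  If D = (C/F, sigma, b) and b = c^p, then y = x^(q/p) satisfies
   (y - c)(y^(p-1) + c y^(p-2) + ... + c^(p-1)) = 0, against the independence of
   the powers of x.

   Conversely, let g = gamma.  Since p does not divide d, the extension
   L = F(mu_q) of F is cyclic, with a generator tau : zeta |-> zeta^r, and
   R = D (x) L is a division algebra with an automorphism tR that fixes D and
   extends tau.  As a is not a p-th power, g^(q/p) is not central, so R contains
   z != 0 with g z = zeta z g, and counting dimensions gives
   R = sum_(i,j) L g^i z^j.  The centralizer of g is the field M = L(g), on which
   z acts by conjugation as an automorphism sigma of order q.

   The point is to replace z by w = k z, with k in M, such that tR(w) lies in
   L w^r.  Up to norms from M to L, z^q can be changed into b with tau(b) in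
   b^r L^q, because d is prime to q; then tR(z) and z^r have the same q-th power
   up to L^q, so Hilbert's theorem 90 for sigma^r shows that they are conjugate
   up to L, and Hilbert's theorem 90 for tau, again with d prime to q, makes the
   conjugating element trivial.

   The elements of D that commute with w then form a field C, with
   D = sum_i C g^i, on which conjugation by g has order q and fixed field F. *)

(** * Norms and Hilbert's theorem 90 for an automorphism of finite order *)

Section IterMorphism.

Variables (S : pzRingType) (f : {rmorphism S -> S}).

Fact iter_zmod_morphism i : zmod_morphism (iter i f).
Proof. by move=> x y; elim: i => //= i ->; rewrite rmorphB. Qed.

Fact iter_monoid_morphism i : monoid_morphism (iter i f).
Proof.
split=> [|x y]; first by elim: i => //= i ->; rewrite rmorph1.
by elim: i => //= i ->; rewrite rmorphM.
Qed.

HB.instance Definition _ i :=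
  GRing.isZmodMorphism.Build S S (iter i f) (iter_zmod_morphism i).
HB.instance Definition _ i :=
  GRing.isMonoidMorphism.Build S S (iter i f) (iter_monoid_morphism i).

End IterMorphism.

(** The length [n] is not tied to the order of [f], because partial norms occur as coefficients in
    powers of a product [h x * w]. *)
Definition cyclic_norm (S : pzSemiRingType) (f : S -> S) n x : S :=
  \prod_(i < n) iter i f x.

Section CyclicNorm.

Variables (K : fieldType) (f : {rmorphism K -> K}) (n : nat).
Local Notation N := (cyclic_norm f n).

Lemma cyclic_normM : {morph N : x y / x * y}.
Proof.
move=> x y; rewrite /cyclic_norm -big_split /=.
by apply: eq_bigr => i _; rewrite rmorphM.
Qed.

Lemma cyclic_norm1 : N 1 = 1.
Proof. by apply: big1 => i _; rewrite rmorph1. Qed.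

Lemma cyclic_normX k : {morph N : x / x ^+ k}.
Proof.
by move=> x; elim: k => [|k IHk]; rewrite ?cyclic_norm1 // !exprS cyclic_normM IHk.
Qed.

Lemma cyclic_normV : {morph N : x / x^-1}.
Proof.
move=> x; rewrite /cyclic_norm -prodfV.
by apply: eq_bigr => i _; rewrite fmorphV.
Qed.

Lemma cyclic_normS i x : cyclic_norm f i.+1 x = x * f (cyclic_norm f i x).
Proof. by rewrite /cyclic_norm big_ord_recl rmorph_prod. Qed.

Lemma cyclic_norm_neq0 x : x != 0 -> N x != 0.
Proof. by move=> x0; apply/prodf_neq0 => i _; rewrite fmorph_eq0. Qed.

Lemma cyclic_norm_fixed x : f x = x -> N x = x ^+ n.
Proof.
move=> fx; rewrite /cyclic_norm (eq_bigr (fun=> x)) ?prodr_const ?card_ord //.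
by move=> i _; rewrite iter_fix.
Qed.

Lemma rmorph_cyclic_norm x : iter n f x = x -> f (N x) = N x.
Proof.
case: n => [|m] fx; rewrite /cyclic_norm rmorph_prod ?big_ord0 //=.
rewrite big_ord_recr big_ord_recl /= mulrC; congr (_ * _).
exact: fx.
Qed.

(* The solution is sought among the resolvents of the [c j]; the dual family
   [w j] certifies that one of them does not vanish. *)
Lemma cyclic_Hilbert90 (I : finType) (c w : I -> K) (k y : K) :
    (forall x, iter n f x = x) -> N y = 1 -> (0 < n)%N -> k != 0 ->
    (forall i, (i < n)%N ->
       \sum_j w j * iter i f (c j) = if i == 0 then k else 0) ->
  exists2 m, m != 0 & y * f m = m.
Proof.
move=> fn Ny1 n_gt0 k0 dual.
pose Y i := cyclic_norm f i y; pose m j := \sum_(i < n) Y i * iter i f (c j).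
have YS i : Y i.+1 = y * f (Y i) by exact: cyclic_normS.
(* Applying [f] and multiplying by [y] shifts the summation index; the last term wraps around to
   index [0] because [N y = 1] and [iter n f] is the identity. *)
have m_eq j : y * f (m j) = m j.
  rewrite /m rmorph_sum mulr_sumr /=; case: n n_gt0 fn Ny1 => // n' _ fn Ny1.
  rewrite big_ord_recr [RHS]big_ord_recl /= addrC; congr (_ + _).
    rewrite rmorphM mulrA -YS /Y Ny1 -[f _]/(iter n'.+1 f (c j)) fn.
    by rewrite /cyclic_norm big_ord0.
  by apply: eq_bigr => i _; rewrite rmorphM mulrA -YS.
have: \sum_j w j * m j = k.
  under eq_bigr do rewrite mulr_sumr.
  rewrite exchange_big /= (bigD1 (Ordinal n_gt0)) //=.
  under eq_bigr do rewrite mulrCA.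
  rewrite -mulr_sumr (dual 0) //= /Y /cyclic_norm big_ord0 mul1r big1 ?addr0 //.
  move=> i ne0; under eq_bigr do rewrite mulrCA.
  by rewrite -mulr_sumr dual // -val_eqE /= in ne0 *; rewrite (negPf ne0) mulr0.
case: (pickP (fun j => m j != 0)) => [j mj _ | m0 S]; first by exists (m j).
case/eqP: k0; rewrite -S big1 // => j _.
by move/(_ j): m0 => /negbFE/eqP->; rewrite mulr0.
Qed.

End CyclicNorm.

(** * Sums over roots of unity and arithmetic modulo [q] *)

Lemma prim_root_neq0 (K : fieldType) (q : nat) (zeta : K) :
  q.-primitive_root zeta -> zeta != 0.
Proof.
move=> prim; apply/eqP => z0; have /eqP := prim_expr_order prim.
by rewrite z0 expr0n gtn_eqF ?(prim_order_gt0 prim) // eq_sym oner_eq0.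
Qed.

Lemma prim_root_sum (K : fieldType) (q : nat) (zeta : K) k :
    q.-primitive_root zeta ->
  \sum_(j < q) (zeta ^+ k) ^+ j = if (q %| k)%N then q%:R else 0.
Proof.
move=> prim; rewrite (prim_order_dvd prim); case: ifPn => [/eqP-> | z1].
  by under eq_bigr do rewrite expr1n; rewrite sumr_const card_ord.
apply/eqP; have /eqP := subrX1 (zeta ^+ k) q.
rewrite -exprM mulnC exprM (prim_expr_order prim) expr1n subrr eq_sym.
by rewrite mulf_eq0 subr_eq0 (negPf z1).
Qed.

(** The powers of [zeta] and of its inverse are dual families; they certify non-vanishing in
    Hilbert's theorem 90 for [tM] and for the trace of [L]. *)
Lemma prim_root_dual (K : fieldType) (q : nat) (zeta : K) c :
    q.-primitive_root zeta -> (0 < c)%N ->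
  \sum_(j < q) zeta ^- j * (zeta ^+ c) ^+ j
    = if zeta ^+ c == zeta then q%:R else 0.
Proof.
move=> prim c_gt0; under eq_bigr do
  rewrite -exprVn -exprMn -[X in _ * zeta ^+ X](prednK c_gt0) exprS
          mulKf ?(prim_root_neq0 prim) //.
rewrite prim_root_sum // -subn1 -eqn_mod_dvd // -(eq_prim_root_expr prim).
by rewrite expr1.
Qed.

(** Multiplication by [r] permutes the residues modulo [q]. *)
Lemma prod_coprime_reindex (S : comPzSemiRingType) (q r : nat) (f : nat -> S) :
    (0 < q)%N -> coprime r q -> (forall i, f (i %% q)%N = f i) ->
  \prod_(i < q) f (r * i)%N = \prod_(i < q) f i.
Proof.
case: q => // q _ co fmod.
pose s (i : 'I_q.+1) : 'I_q.+1 := inord (r * i %% q.+1).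
have sE i : s i = (r * i %% q.+1)%N :> nat by rewrite inordK ?ltn_pmod.
have sI : injective s.
  move=> i j /(congr1 val) /=; rewrite !sE => eij; apply: val_inj => /=.
  wlog le_ij : i j eij / (i <= j)%N.
    by move=> IH; case/orP: (leq_total i j) => /IH-> //.
  have /eqP := esym eij; rewrite eqn_mod_dvd ?leq_mul // -mulnBr.
  rewrite Gauss_dvdr 1?coprime_sym // => /dvdn_leq.
  case: posnP => [/eqP | _ /(_ isT)].
    by rewrite subn_eq0 => le_ji _; apply/eqP; rewrite eqn_leq le_ij.
  by rewrite leqNgt ltnS (leq_trans (leq_subr _ _)) // -ltnS.
rewrite [RHS](reindex_inj sI) /=; apply: eq_bigr => i _.
by rewrite sE fmod.
Qed.

Lemma coprime_mul_inv (m q : nat) :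
  (0 < m)%N -> coprime m q -> exists s c, (s * m = q * c + 1)%N.
Proof.
move=> m_gt0 /eqP co; case: (egcdnP q m_gt0) => s c; rewrite co => E _.
by exists s, c; rewrite E mulnC.
Qed.

(** In natural numbers [q.-1 * k] stands for [- k] modulo [q]; inverse powers of roots of unity are
    written in this way below. *)
Lemma eigen_exponent (q : nat) (j k : 'I_q) :
  (q %| j + q.-1 * k)%N = (j == k).
Proof.
have q_gt0 : (0 < q)%N by case: q j {k} => [[] |].
have -> : (q %| j + q.-1 * k)%N = (j + q.-1 * k + k == 0 + k %[mod q])%N.
  by rewrite eqn_modDr mod0n.
by rewrite -addnA -mulSnr prednK // addnC mulnC modnMDl add0n !modn_small.
Qed.

(** * An equivariant eigenvector in a division algebra with semilinear action *)

Section Descent.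

Variables (L M : fieldType) (eps : {rmorphism L -> M}).
Variables (sg tM : {rmorphism M -> M}) (tL : {rmorphism L -> L}).
Variables (q r d : nat) (zeta a : L) (g : M).

Local Notation Z := (eps zeta).
Local Notation N := (cyclic_norm sg q).

Hypotheses (zeta_prim : q.-primitive_root zeta) (q_neq0 : q%:R != 0 :> L).
Hypotheses (g_neq0 : g != 0) (gq : g ^+ q = eps a).
Hypotheses (sg_g : Z * sg g = g) (sg_eps : forall e, sg (eps e) = eps e).
Hypothesis M_gen :
  forall x, exists f : 'I_q -> L, x = \sum_(i < q) eps (f i) * g ^+ i.
Hypotheses (tM_g : tM g = g) (tM_eps : forall e, tM (eps e) = eps (tL e)).
Hypotheses (tLd : forall e, iter d tL e = e) (tL_zeta : tL zeta = zeta ^+ r).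
Hypothesis r_order : forall i, (0 < i < d)%N -> zeta ^+ (r ^ i) != zeta.
Hypotheses (d_gt0 : (0 < d)%N) (r_gt0 : (0 < r)%N).
Hypotheses (co_dq : coprime d q) (co_rq : coprime r q).

Let q_gt0 : (0 < q)%N := prim_order_gt0 zeta_prim.
Let Z_prim : q.-primitive_root Z.
Proof. by rewrite fmorph_primitive_root. Qed.
Let qM_neq0 : q%:R != 0 :> M.
Proof. by rewrite -(rmorph_nat eps) fmorph_eq0. Qed.

Let sg_gX : sg g = Z ^+ q.-1 * g.
Proof.
have Z0 := prim_root_neq0 Z_prim.
by apply: (mulfI Z0); rewrite sg_g mulrA -exprS prednK // (prim_expr_order Z_prim) mul1r.
Qed.

Lemma iter_sg_g i j : iter i sg (g ^+ j) = Z ^+ (q.-1 * i * j) * g ^+ j.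
Proof.
suff E : iter i sg g = Z ^+ (q.-1 * i) * g by rewrite rmorphXn /= E exprMn -exprM.
elim: i => [|i IHi]; first by rewrite muln0 mul1r.
rewrite iterS IHi rmorphM rmorphXn /= sg_eps sg_gX mulrA -exprD.
by rewrite mulnS addnC.
Qed.

Lemma eq_on_generator (f1 f2 : {rmorphism M -> M}) :
  (forall e, f1 (eps e) = f2 (eps e)) -> f1 g = f2 g -> f1 =1 f2.
Proof.
move=> fE fg x; have [f ->] := M_gen x; rewrite !rmorph_sum.
by apply: eq_bigr => i _; rewrite !rmorphM !rmorphXn /= fE fg.
Qed.

Lemma iter_sg_eps i e : iter i sg (eps e) = eps e.
Proof. exact: iter_fix. Qed.

Lemma iter_sg_order x : iter q sg x = x.
Proof.
apply: (@eq_on_generator (iter q sg) idfun) => [e|]; first exact: iter_sg_eps.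
rewrite /=; have:= iter_sg_g q 1; rewrite expr1 => ->; rewrite muln1 mulnC exprM.
by rewrite (prim_expr_order Z_prim) expr1n mul1r.
Qed.

Lemma iter_sg_mod i x : iter (i %% q)%N sg x = iter i sg x.
Proof.
rewrite {2}(divn_eq i q) addnC iterD; congr iter.
by elim: (i %/ q)%N => // k IHk; rewrite mulSn iterD -IHk iter_sg_order.
Qed.

Lemma iter_tM_eps i e : iter i tM (eps e) = eps (iter i tL e).
Proof. by elim: i => //= i ->. Qed.

Lemma iter_tM_order x : iter d tM x = x.
Proof.
apply: (@eq_on_generator (iter d tM) idfun) => [e|]; last exact: iter_fix.
by rewrite /= iter_tM_eps tLd.
Qed.

(** As [tL] raises [zeta] to the power [r], [tM] carries [sg] to its [r]-th power; it suffices to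
    compare both sides on [L] and on [g]. *)
Lemma tM_iter_sg i x : tM (iter i sg x) = iter (r * i) sg (tM x).
Proof.
have comm : tM \o sg =1 iter r sg \o tM.
  apply: eq_on_generator => [e|]; first by rewrite /= sg_eps tM_eps iter_sg_eps.
  have:= iter_sg_g r 1; rewrite expr1 /= sg_gX rmorphM rmorphXn /= tM_eps => E.
  by rewrite tM_g E tL_zeta rmorphXn -exprM muln1 mulnC.
elim: i => [|i IHi]; first by rewrite muln0.
by rewrite iterS [LHS]comm /= IHi -iterD mulnS.
Qed.

Lemma tL_iter_zeta i : iter i tL zeta = zeta ^+ (r ^ i).
Proof.
elim: i => //= i ->; rewrite rmorphXn /= tL_zeta -exprM.
by rewrite expnS.
Qed.

(** Applying [tL] to [zeta] [d] times raises it to the power [r ^ d], yet must give [zeta] back. *)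
Lemma expn_rd : exists c, (r ^ d = q * c + 1)%N.
Proof.
have /eqP : zeta ^+ (r ^ d) = zeta ^+ 1 by rewrite -tL_iter_zeta tLd.
rewrite (eq_prim_root_expr zeta_prim) eqn_mod_dvd ?expn_gt0 ?r_gt0 //.
case/dvdnP=> c E; exists c; rewrite mulnC -E subnK // expn_gt0 r_gt0 //.
Qed.

(** By [tM_iter_sg] the left side is a product of conjugates of [tM x] with indices multiplied by
    [r], which is a permutation modulo [q]. *)
Lemma tM_norm x : tM (N x) = N (tM x).
Proof.
rewrite rmorph_prod /=; under eq_bigr do rewrite tM_iter_sg.
rewrite (prod_coprime_reindex (f := fun i => iter i sg (tM x))) // => i.
exact: iter_sg_mod.
Qed.

Lemma norm_iter_r x : cyclic_norm (iter r sg) q x = N x.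
Proof.
rewrite -[RHS](prod_coprime_reindex (f := fun i => iter i sg x) q_gt0 co_rq).
  by apply: eq_bigr => i _; rewrite mulnC iterM.
by move=> i; rewrite iter_sg_mod.
Qed.

(** A Lagrange resolvent: [sg] scales [g ^+ k] by the inverse of [Z ^+ k], so weighting by powers of
    [Z ^+ j] kills every component except the [j]-th. *)
Lemma resolvent (f : 'I_q -> L) (j : 'I_q) :
  let x := \sum_(i < q) eps (f i) * g ^+ i in
  \sum_(i < q) Z ^+ (j * i) * iter i sg x = q%:R * (eps (f j) * g ^+ j).
Proof.
move=> x; under eq_bigr => i _ do rewrite rmorph_sum mulr_sumr /=.
have E (i k : 'I_q) : Z ^+ (j * i) * iter i sg (eps (f k) * g ^+ k)
    = eps (f k) * g ^+ k * (Z ^+ (j + q.-1 * k)) ^+ i.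
  rewrite rmorphM /= iter_sg_eps iter_sg_g -exprM mulnDl exprD [in RHS]mulnAC.
  by rewrite mulrCA -[RHS]mulrA; congr (_ * _); rewrite [RHS]mulrC mulrA.
under eq_bigr do under eq_bigr do rewrite E.
rewrite exchange_big (bigD1 j) //= -mulr_sumr prim_root_sum //.
rewrite eigen_exponent eqxx big1 ?addr0 1?mulrC // => k nkj.
by rewrite -mulr_sumr prim_root_sum // eigen_exponent eq_sym (negPf nkj) mulr0.
Qed.

(** For fixed [x] the resolvent of index [0] is [q] times [x], and also [q] times the constant
    coefficient. *)
Lemma sg_fixed x : sg x = x -> exists e, x = eps e.
Proof.
have [f Dx] := M_gen x => sx.
have:= resolvent f (Ordinal q_gt0); rewrite /= -Dx (mulr1 (eps _)).
under eq_bigr do rewrite mul0n mul1r iter_fix //.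
rewrite sumr_const card_ord -[x *+ q]mulr_natl => /(mulfI qM_neq0) Dx0.
by exists (f (Ordinal q_gt0)).
Qed.

(** Each resolvent of an eigenvector is a multiple of it by an element of [L]. The one attached to a
    non-zero coefficient shows that [x] is a monomial. *)
Lemma sg_eigenvector x c :
  x != 0 -> sg x = eps c * x -> exists e (j : 'I_q), x = eps e * g ^+ j.
Proof.
move=> x0 sx; have [f Dx] := M_gen x.
have iter_x i : iter i sg x = eps (c ^+ i) * x.
  elim: i => [|i IHi]; first by rewrite rmorph1 mul1r.
  by rewrite iterS IHi rmorphM /= sg_eps sx mulrA -rmorphM exprSr.
have sumx (j : 'I_q) :
    eps (\sum_(i < q) zeta ^+ (j * i) * c ^+ i) * x = q%:R * (eps (f j) * g ^+ j).
  rewrite -resolvent -Dx rmorph_sum mulr_suml; apply: eq_bigr => i _.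
  by rewrite iter_x rmorphM rmorphXn mulrA.
case: (pickP (fun j => f j != 0)) => [j fj | f0].
  have C0 : \sum_(i < q) zeta ^+ (j * i) * c ^+ i != 0.
    apply: contra fj => /eqP E; have := sumx j; rewrite E rmorph0 mul0r.
    move/esym/eqP; rewrite !mulf_eq0 (negPf qM_neq0) expf_eq0 (negPf g_neq0).
    by rewrite andbF orbF fmorph_eq0.
  move: C0 (sumx j); set C := \sum_(i < q) _ => C0 {}sumx.
  exists (q%:R * f j / C), j.
  have C1 : eps C != 0 by rewrite fmorph_eq0.
  apply: (mulfI C1); rewrite sumx mulrA [RHS]mulrA -rmorphM [C * _]mulrC.
  by rewrite divfK // rmorphM rmorph_nat.
case/eqP: x0; rewrite Dx big1 // => i _.
by have /negbFE/eqP-> := f0 i; rewrite rmorph0 mul0r.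
Qed.

Lemma norm_eps x : exists e, N x = eps e.
Proof. by apply: sg_fixed; rewrite rmorph_cyclic_norm ?iter_sg_order. Qed.

(** The powers of [g] and of its inverse are dual families here, since [iter r sg] scales [g] by a
    primitive [q]-th root of unity. *)
Lemma Hilbert90_sg y :
  N y = 1 -> exists2 m, m != 0 & y * iter r sg m = m.
Proof.
rewrite -norm_iter_r => Ny.
apply: (cyclic_Hilbert90 (c := fun j : 'I_q => g ^+ j) (w := fun j => g ^- j)
         _ Ny q_gt0 qM_neq0).
  by move=> x; rewrite -iterM mulnC iterM iter_fix ?iter_sg_order.
move=> i lt_iq; under eq_bigr => j _.
  rewrite -iterM iter_sg_g mulrCA mulVf ?expf_neq0 // mulr1 exprM; over.
rewrite prim_root_sum // Gauss_dvdr ?coprimenP // 1?mulnC ?Gauss_dvdr //.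
- by rewrite /dvdn modn_small.
- by rewrite coprime_sym.
Qed.

(** Here the powers of [Z] are used; [r_order] says that the conjugates of [zeta] of index strictly
    between [0] and [d] differ from [zeta]. *)
Lemma Hilbert90_tM y :
  cyclic_norm tM d y = 1 -> exists2 m, m != 0 & y * tM m = m.
Proof.
move=> Ny.
apply: (cyclic_Hilbert90 (c := fun j : 'I_q => Z ^+ j) (w := fun j => Z ^- j)
         _ Ny d_gt0 qM_neq0).
  exact: iter_tM_order.
move=> i lt_id; under eq_bigr do rewrite rmorphXn /= iter_tM_eps tL_iter_zeta rmorphXn.
rewrite prim_root_dual ?expn_gt0 ?r_gt0 // -rmorphXn (inj_eq (fmorph_inj eps)).
case: i lt_id => [|i] lt_id; first by rewrite expr1 eqxx.
by rewrite (negPf (r_order _)).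
Qed.

Variables (R : unitRingType) (h : {rmorphism M -> R}) (tR : {rmorphism R -> R}).
Hypothesis tR_h : forall x, tR (h x) = h (tM x).
Hypothesis tRd : forall x, iter d tR x = x.

Let h_unit x : x != 0 -> h x \is a GRing.unit.
Proof. by move=> x0; rewrite rmorph_unit ?unitfE. Qed.

Let h_comm x y : h x * h y = h y * h x.
Proof. by rewrite -!rmorphM mulrC. Qed.

Lemma norm_exp (s : {rmorphism M -> M}) (w : R) x i :
    (forall y, w * h y = h (s y) * w) ->
  (h x * w) ^+ i = h (cyclic_norm s i x) * w ^+ i.
Proof.
move=> wE; elim: i => [|i IHi]; first by rewrite /cyclic_norm big_ord0 rmorph1 mulr1.
rewrite exprS IHi cyclic_normS rmorphM exprS -!mulrA; congr (_ * _).
by rewrite !mulrA wE.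
Qed.

Section Conjugator.

Variables (z : R) (k : M) (b : L).
Hypotheses (z_unit : z \is a GRing.unit) (zE : forall x, z * h x = h (sg x) * z).
Hypotheses (zq : z ^+ q = h (eps b)) (tR_z : tR z = h k * z ^+ r).

Lemma conj_expr i x : z ^+ i * h x = h (iter i sg x) * z ^+ i.
Proof.
elim: i => [|i IHi]; first by rewrite mul1r mulr1.
by rewrite exprS -mulrA IHi mulrA zE -mulrA.
Qed.

Let b_neq0 : b != 0.
Proof.
apply/eqP => b0; have := unitrX q z_unit.
by rewrite zq b0 !rmorph0 unitr0.
Qed.

(** Compare the [q]-th powers of both sides of [tR z = h k * z ^+ r]. *)
Lemma tL_norm : eps (tL b) = N k * eps b ^+ r.
Proof.
apply: (fmorph_inj h); rewrite -tM_eps -tR_h -zq rmorphXn /= tR_z.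
rewrite (norm_exp _ _ (conj_expr r)) norm_iter_r -exprM mulnC exprM zq.
by rewrite rmorphM rmorphXn.
Qed.

(** Iterating [tL_norm]: modulo norms from [M], the automorphism [tL] acts on [b] as the [r]-th
    power. *)
Lemma iter_tL_norm i : exists x, eps (iter i tL b) = N x * eps b ^+ (r ^ i).
Proof.
elim: i => [|i [x E]]; first by exists 1; rewrite cyclic_norm1 mul1r.
exists (tM x * k ^+ (r ^ i)); rewrite iterS -tM_eps E rmorphM rmorphXn /= tM_norm.
by rewrite tM_eps tL_norm exprMn -exprM -expnS cyclic_normM cyclic_normX mulrA.
Qed.

(* The exponents make [b1] an eigenvector of [tL] modulo [q]-th powers, while
   [s * d = 1 %[mod q]] makes it equal to [b] modulo norms. *)
Lemma eigen_conjugator : exists x b1 e,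
  [/\ x != 0, e != 0, (h x * z) ^+ q = h (eps b1) & tL b1 * e ^+ q = b1 ^+ r].
Proof.
have [s [c0 sd]] := coprime_mul_inv d_gt0 co_dq; have [c1 rd] := expn_rd.
(* Modulo norms every factor equals [b ^+ (s * r ^ d)], so [b1] is [b ^+ (d * s * r ^ d)], whose
   exponent is [1] modulo [q]. *)
pose b1 := \prod_(i < d) iter i tL b ^+ (s * r ^ (d - i)).
have norm_prod m : (m <= d)%N -> exists x,
    eps (\prod_(i < m) iter i tL b ^+ (s * r ^ (d - i)))
      = N x * eps b ^+ (m * (s * r ^ d)).
  elim: m => [|m IHm] lt_md.
    by exists 1; rewrite big_ord0 rmorph1 cyclic_norm1 mul1r.
  have [x1 E1] := IHm (ltnW lt_md); have [x2 E2] := iter_tL_norm m.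
  exists (x1 * x2 ^+ (s * r ^ (d - m))); rewrite big_ord_recr rmorphM E1 /=.
  rewrite rmorphXn E2 exprMn -exprM cyclic_normM cyclic_normX mulrACA -exprD.
  by rewrite [(r ^ m * _)%N]mulnCA -expnD subnKC 1?ltnW // mulSn addnC.
have [x Dx] := norm_prod d (leqnn d); rewrite -/b1 in Dx.
have [c Dc] : exists c, (d * (s * r ^ d) = q * c + 1)%N.
  exists (c0 * r ^ d + c1)%N.
  by rewrite mulnA [(d * s)%N]mulnC sd mulnDl mul1n {2}rd mulnDr mulnA addnA.
(* The surplus power [b ^+ (q * c)] is the norm of [eps b ^+ c]; the third witness absorbs the
   excess of [r ^ d = q * c1 + 1] over [1]. *)
exists (x * eps b ^+ c), b1, (b ^+ (s * r * c1)).
have x0 : x * eps b ^+ c != 0.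
  rewrite mulf_neq0 ?expf_neq0 ?fmorph_eq0 //; apply: contra_eq_neq Dx => ->.
  rewrite {1}/cyclic_norm -(prednK q_gt0) big_ord_recl /= mul0r mul0r fmorph_eq0.
  apply/prodf_neq0 => i _; rewrite expf_neq0 //.
  by rewrite (fmorph_eq0 (iter i tL)).
split=> //; first by rewrite expf_neq0.
  rewrite (norm_exp _ _ zE) zq -rmorphM Dx Dc cyclic_normM cyclic_normX.
  by rewrite (cyclic_norm_fixed _ (sg_eps b)) exprD expr1 -exprM mulrA.
apply: (mulIf (expf_neq0 (s * r) b_neq0)); rewrite -mulrA -exprM -exprD.
have -> : (s * r * c1 * q + s * r = s * r ^ d.+1)%N.
  by rewrite expnS mulnA rd mulnDr muln1 -!mulnA [(c1 * q)%N]mulnC.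
(* The same product of [d.+1] factors is computed twice: removing the factor [i = 0] leaves [tL b1],
   and removing [i = d], where [iter d tL b = b], leaves [b1 ^+ r]. *)
have shift : \prod_(i < d.+1) iter i tL b ^+ (s * r ^ (d.+1 - i))
    = tL b1 * b ^+ (s * r ^ d.+1).
  rewrite big_ord_recl mulrC rmorph_prod /=; congr (_ * _).
  by apply: eq_bigr => i _; rewrite rmorphXn /= subSS.
rewrite -shift big_ord_recr /= tLd subSnn expn1 -prodrXl; congr (_ * _).
apply: eq_bigr => i _; rewrite -exprM -mulnA -expnSr subSn //.
exact: ltnW.
Qed.

(** Both sides of [h y * z ^+ r = h (eps e) * tR z] have the same [q]-th power as [z ^+ r], so [y]
    has norm [1]. Writing [y = m / iter r sg m] turns the left side into the conjugate of [z ^+ r]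
    by [m]. *)
Lemma tR_conjugate e : tL b * e ^+ q = b ^+ r -> e != 0 ->
  exists m e1, [/\ m != 0, e1 != 0 & tR z * h m = h m * h (eps e1) * z ^+ r].
Proof.
move=> tLb e0; pose y := eps e * k.
have Dy : h y * z ^+ r = h (eps e) * tR z by rewrite tR_z mulrA -rmorphM.
have Ny : N y = 1.
  apply: (fmorph_inj h); apply: (mulIr (unitrX q (unitrX r z_unit))).
  rewrite -norm_iter_r -(norm_exp _ _ (conj_expr r)) Dy rmorph1 mul1r.
  rewrite exprMn_comm; last first.
    by rewrite tR_z /GRing.comm mulrA -rmorphM [_ * k]mulrC rmorphM -!mulrA
               conj_expr iter_sg_eps.
  rewrite -rmorphXn -[tR z ^+ q]rmorphXn zq tR_h tM_eps -rmorphM -rmorphXn.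
  by rewrite -rmorphM mulrC tLb -exprM mulnC exprM zq -!rmorphXn.
have [m m0 ym] := Hilbert90_sg Ny.
exists m, e^-1; split; rewrite ?invr_eq0 //.
apply: (mulrI (h_unit (_ : eps e != 0))); first by rewrite fmorph_eq0.
rewrite mulrA -Dy -mulrA conj_expr mulrA -rmorphM ym.
rewrite !mulrA; congr (_ * _).
by rewrite -!rmorphM fmorphV mulrAC divff ?fmorph_eq0 // mul1r.
Qed.

(* The [tM]-norm of [m] is an eigenvector of [sg], hence of the form
   [eps e * g ^+ j]; multiplying [m] by a power of [g] removes [g ^+ j], since
   the number [d] of conjugates is prime to [q]. *)
Lemma tR_conjugate_twist m e1 :
    m != 0 -> e1 != 0 -> tR z * h m = h m * h (eps e1) * z ^+ r ->
  exists m' e1' e2, [/\ m' != 0, cyclic_norm tM d m' = eps e2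
    & tR z * h m' = h m' * h (eps e1') * z ^+ r].
Proof.
move=> m0 e10 E.
(* The relation [E] is iterated along [tR]; after [d] steps [tR] has returned [z] to itself and [m]
   has become its [tM]-norm. *)
have [e e_neq0 Ed] : exists2 e, e != 0 &
    z * h (cyclic_norm tM d m) = h (cyclic_norm tM d m) * h (eps e) * z ^+ (r ^ d).
  rewrite -{1}[z]tRd; elim: d => [|i [e e_neq0 IHi]].
    exists 1; rewrite ?oner_eq0 //.
    by rewrite /cyclic_norm big_ord0 !rmorph1 mul1r mulr1 mul1r.
  exists (tL e * e1 ^+ (r ^ i)).
    by rewrite mulf_neq0 ?expf_neq0 ?fmorph_eq0.
  have step j : tR z ^+ j * h m = h m * h (eps e1 ^+ j) * z ^+ (r * j).
    elim: j => [|j IHj]; first by rewrite muln0 rmorph1 !mulr1 mul1r.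
    rewrite exprSr -mulrA E !mulrA IHj.
    rewrite -[_ * z ^+ (r * j) * h (eps e1)]mulrA conj_expr iter_sg_eps.
    rewrite !mulrA -[_ * _ * z ^+ r]mulrA -exprD mulnS addnC.
    by rewrite -[h m * _ * _]mulrA -rmorphM exprSr.
  rewrite iterS cyclic_normS mulrC (rmorphM h) mulrA -tR_h -rmorphM IHi.
  rewrite !(rmorphM tR) rmorphXn /= !tR_h tM_eps -mulrA step expnS !mulrA.
  congr (_ * _); rewrite -!rmorphM; apply: (congr1 h).
  by rewrite rmorphM rmorphXn -!mulrA; congr (_ * _); rewrite mulrCA.
have [c rd] := expn_rd.
(* Since [r ^ d = q * c + 1], the power [z ^+ (r ^ d)] is [b ^+ c] times [z]; hence the [tM]-norm of
   [m] is an eigenvector of [sg]. *)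
have [e3 [j Dm]] : exists e3 (j : 'I_q), cyclic_norm tM d m = eps e3 * g ^+ j.
  apply: (@sg_eigenvector _ (e * b ^+ c)); first exact: cyclic_norm_neq0.
  apply: (fmorph_inj h); apply: (mulIr z_unit); rewrite -zE Ed rd exprD exprM.
  rewrite zq expr1 mulrA -rmorphXn -!rmorphM /=; congr (h _ * _).
  by rewrite -mulrA mulrC rmorphM rmorphXn.
have [s [c0 sd]] := coprime_mul_inv d_gt0 co_dq.
(* Modulo [q], [d * t] is [- j]. As [tM] fixes [g], the factor [g ^+ t] contributes [g ^+ (d * t)]
   to the norm, leaving a power of [g ^+ q], which lies in [L]. *)
pose t := (s * (q - j))%N.
have expo : (j + d * t = q * (c0 * (q - j)).+1)%N.
  rewrite /t mulnA [(d * s)%N]mulnC sd mulnDl mul1n -mulnA addnCA.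
  by rewrite subnKC 1?ltnW // -mulnSr.
exists (m * g ^+ t), (e1 * zeta ^+ (q.-1 * r * t)), (e3 * a ^+ (c0 * (q - j)).+1).
split.
- by rewrite mulf_neq0 ?expf_neq0.
- rewrite cyclic_normM cyclic_normX (cyclic_norm_fixed _ tM_g) Dm -mulrA -exprM.
  by rewrite -exprD expo [RHS]rmorphM rmorphXn /= -gq -exprM.
- rewrite rmorphM mulrA E -mulrA conj_expr iter_sg_g !rmorphM !rmorphXn /= !mulrA.
  congr (_ * _); rewrite -!rmorphXn -!rmorphM; congr (h _).
  by rewrite -!mulrA; congr (_ * _); rewrite [RHS]mulrC -mulrA.
Qed.

(* [e2 ^+ d] and [e2 ^+ q] are both [tM]-norms from [L], and [d] is prime to [q]. *)
Lemma tR_conjugate_norm1 m e1 e2 :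
    m != 0 -> cyclic_norm tM d m = eps e2 ->
    tR z * h m = h m * h (eps e1) * z ^+ r ->
  exists m', [/\ m' != 0, cyclic_norm tM d m' = 1
    & tR z * h m' = h m' * h (eps e1) * z ^+ r].
Proof.
move=> m0 Nm E.
have e2_neq0 : e2 != 0 by rewrite -(fmorph_eq0 eps) -Nm cyclic_norm_neq0.
have tM_e2 : tM (eps e2) = eps e2.
  by rewrite -Nm rmorph_cyclic_norm ?iter_tM_order.
have [e3 De3] := norm_eps m.
(* The norms for [tM] and [sg] commute, so this is the [sg]-norm of [eps e2]. *)
have Ne3 : cyclic_norm tM d (eps e3) = eps (e2 ^+ q).
  have iterN i : iter i tM (N m) = N (iter i tM m).
    by elim: i => //= i ->; rewrite tM_norm.
  rewrite rmorphXn -(cyclic_norm_fixed _ (sg_eps e2)) -Nm -De3.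
  rewrite [in RHS]/(cyclic_norm tM) (big_morph _ (cyclic_normM sg q) (cyclic_norm1 sg q)).
  by apply: eq_bigr => i _; rewrite iterN.
have e3_neq0 : e3 != 0.
  by rewrite -(fmorph_eq0 eps) -De3 cyclic_norm_neq0.
have [s [c sd]] := coprime_mul_inv d_gt0 co_dq.
(* The norms of [e2] and [e3] are [e2 ^+ d] and [e2 ^+ q], and [s * d - q * c = 1], so [v] has norm
   [e2]. *)
pose v := e2 ^+ s / e3 ^+ c.
have v_neq0 : v != 0 by rewrite mulf_neq0 ?invr_eq0 ?expf_neq0.
have Nv : cyclic_norm tM d (eps v) = eps e2.
  rewrite /v rmorphM fmorphV !rmorphXn cyclic_normM cyclic_normV !cyclic_normX.
  rewrite Ne3 (cyclic_norm_fixed _ tM_e2) rmorphXn -!exprM mulnC sd exprD expr1.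
  by rewrite mulrC mulKf // expf_neq0 ?fmorph_eq0.
exists (m / eps v); split.
- by rewrite mulf_neq0 ?invr_eq0 ?fmorph_eq0.
- by rewrite cyclic_normM cyclic_normV Nv Nm divff ?fmorph_eq0.
rewrite -fmorphV rmorphM mulrA E -mulrA conj_expr iter_sg_eps !mulrA.
by congr (_ * _); rewrite -!rmorphM mulrAC.
Qed.

(** Hilbert's theorem 90 gives [m = l / tM l]; conjugating [z] by [l] then cancels the conjugation
    by [m] that relates [tR z] to [z ^+ r]. *)
Lemma tR_equivariant_conjugate m e1 :
    m != 0 -> cyclic_norm tM d m = 1 ->
    tR z * h m = h m * h (eps e1) * z ^+ r ->
  exists l, l != 0 /\ tR (h l * z * h l^-1) = h (eps e1) * (h l * z * h l^-1) ^+ r.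
Proof.
move=> m0 Nm E; have [l l0 ml] := Hilbert90_tM Nm; exists l; split=> //.
have conjX j : (h l * z * h l^-1) ^+ j = h l * z ^+ j * h l^-1.
  elim: j => [|j IHj]; first by rewrite mulr1 -rmorphM divff // rmorph1.
  rewrite exprS IHj [z ^+ j.+1]exprS -!mulrA; congr (_ * (_ * _)).
  by rewrite mulrA -rmorphM mulVf // rmorph1 mul1r.
rewrite conjX !rmorphM !tR_h.
have -> : tR z = h m * h (eps e1) * z ^+ r * h m^-1.
  by rewrite -E -mulrA -rmorphM divff // rmorph1 mulr1.
rewrite !mulrA -rmorphM [tM l * m]mulrC ml [h (eps e1) * h l]h_comm -!mulrA.
do 3![congr (_ * _)]; rewrite -rmorphM; congr (h _).
by rewrite -{2}ml invfM fmorphV.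
Qed.

End Conjugator.

Lemma equivariant_conjugator (z : R) (k : M) (b : L) :
    z \is a GRing.unit -> (forall x, z * h x = h (sg x) * z) ->
    z ^+ q = h (eps b) -> tR z = h k * z ^+ r ->
  exists x b' e, let w := h x * z in
    [/\ x != 0, w ^+ q = h (eps b') & tR w = h (eps e) * w ^+ r].
Proof.
move=> z_unit zE zq tR_z.
have [x1 [b1 [e [x1_neq0 e_neq0 z1q tL_b1]]]] := eigen_conjugator z_unit zE zq tR_z.
set z1 := h x1 * z in z1q.
have z1_unit : z1 \is a GRing.unit by rewrite unitrMl ?h_unit.
have z1E x : z1 * h x = h (sg x) * z1.
  by rewrite /z1 -mulrA zE !mulrA h_comm.
have tR_z1 : tR z1 = h (tM x1 * k / cyclic_norm sg r x1) * z1 ^+ r.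
  rewrite /z1 (norm_exp _ _ zE) mulrA -rmorphM divfK ?cyclic_norm_neq0 //.
  by rewrite !rmorphM tR_h tR_z mulrA.
have [m [e1 [m0 e1_neq0 E]]] := tR_conjugate z1_unit z1E z1q tR_z1 tL_b1 e_neq0.
have [m1 [e2 [e3 [m10 Nm1 {}E]]]] := tR_conjugate_twist z1_unit z1E z1q m0 e1_neq0 E.
have [m2 [m20 Nm2 {}E]] := tR_conjugate_norm1 z1E m10 Nm1 E.
have [l [l0 tRw]] := tR_equivariant_conjugate m20 Nm2 E.
(* Conjugation by [l] is left multiplication by [l / sg l], which has norm [1], so the [q]-th power
   stays in [L]. *)
have Dw : h (l / sg l * x1) * z = h l * z1 * h l^-1.
  by rewrite -[RHS]mulrA z1E fmorphV !rmorphM /z1 !mulrA.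
exists (l / sg l * x1), b1, e2; split.
- by rewrite !mulf_neq0 ?invr_eq0 ?fmorph_eq0.
- rewrite Dw -mulrA z1E mulrA -rmorphM (norm_exp _ _ z1E) z1q.
  rewrite cyclic_normM fmorphV cyclic_normV.
  have -> : N (sg l) = N l.
    rewrite -[RHS](rmorph_cyclic_norm (iter_sg_order l)) rmorph_prod.
    by apply: eq_bigr => i _; rewrite -iterSr.
  by rewrite divff ?cyclic_norm_neq0 // rmorph1 mul1r.
- by rewrite Dw.
Qed.

End Descent.

(** * Base change of a division algebra to an extension of coprime degree *)

Section BaseChange.

Variable F : fieldType.

Lemma skew_field_rmorph_inj (D R : falgType F) (f : {rmorphism D -> R}) :
  GRing.field_axiom D -> injective f.
Proof.
move=> fieldD x y fxy; apply/eqP; rewrite -subr_eq0; apply/negPn/negP => /fieldD u.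
by have := rmorph_unit f u; rewrite rmorphB fxy subrr unitr0.
Qed.

(** Through [delta], [M] is a left vector space over [D], hence built up from lines [delta x * y],
    each of dimension [\dim {:D}]. *)
Lemma skew_submodule_dim (D R : falgType F) (delta : {lrmorphism D -> R})
    (M : {vspace R}) :
    GRing.field_axiom D -> (forall x, {in M, forall u, delta x * u \in M}) ->
  (\dim {:D} %| \dim M)%N.
Proof.
move=> fieldD stabM.
suff IH k (N : {vspace R}) : (\dim M - \dim N < k)%N -> (N <= M)%VS ->
    (forall x, {in N, forall u, delta x * u \in N}) ->
    (\dim {:D} %| \dim N)%N -> (\dim {:D} %| \dim M)%N.
  apply: (IH _ 0%VS (ltnSn _)); rewrite ?sub0v ?dimv0 ?dvdn0 // => x u.
  by rewrite memv0 => /eqP->; rewrite mulr0 mem0v.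
elim: k N => // k IHk N ltk sNM stabN dvdN.
have [sMN | /subvPn[y My N'y]] := boolP (M <= N)%VS.
  by rewrite (_ : M = N) //; apply/eqP; rewrite eqEsubv sMN.
pose f := (amulr y \o linfun delta)%VF.
have fE x : f x = delta x * y by rewrite comp_lfunE !lfunE.
(* If a non-zero multiple of [y] lay in the stable subspace [N], multiplying by the inverse scalar
   would put [y] in [N]. *)
have trivI : (N :&: limg f = 0)%VS.
  apply/eqP; rewrite -subv0; apply/subvP => u /memv_capP[Nu /memv_imgP[x _ Du]].
  move: Nu; rewrite {u}Du fE memv0.
  have [-> | x0] := eqVneq x 0; first by rewrite rmorph0 mul0r.
  move/(stabN x^-1); rewrite mulrA -rmorphM mulVr ?fieldD // rmorph1 mul1r.
  by rewrite (negPf N'y).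
have kerf : lker f == 0%VS.
  rewrite -subv0; apply/subvP => x; rewrite memv_ker fE memv0 => xy0.
  apply: contraNT N'y => x0; rewrite -[y]mul1r -(rmorph1 delta).
  by rewrite -(mulVr (fieldD _ x0)) rmorphM -mulrA (eqP xy0) mulr0 mem0v.
have dimf : \dim (limg f) = \dim {:D} by rewrite limg_dim_eq ?(eqP kerf) ?capv0.
have dimD_gt0 : (0 < \dim {:D})%N by rewrite adim_gt0.
have dimNf : \dim (N + limg f) = (\dim N + \dim {:D})%N.
  by rewrite dimv_disjoint_sum // dimf.
have sNfM : (N + limg f <= M)%VS.
  rewrite subv_add sNM; apply/subvP => _ /memv_imgP[x _ ->].
  by rewrite fE stabM.
apply: (IHk (N + limg f)%VS) => //.
- have := dimvS sNfM; rewrite dimNf => le.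
  rewrite -ltnS (leq_trans _ ltk) // ltnS ltn_sub2l //.
    by rewrite (leq_trans _ le) // -{1}[\dim N]addn0 ltn_add2l.
  by rewrite -{1}[\dim N]addn0 ltn_add2l.
- move=> x _ /memv_addP[u Nu [_ /memv_imgP[x1 _ ->] ->]].
  rewrite mulrDr memv_add ?stabN // fE mulrA -rmorphM -fE memv_img ?memvf //.
- by rewrite dimNf dvdn_addr.
Qed.

(* Applied to left ideals, this shows that a tensor product of a division
   algebra and a field of coprime dimensions is a division algebra. *)
Lemma coprime_submodule_dim (D : falgType F) (L : fieldExtType F) (R : falgType F)
    (delta : {lrmorphism D -> R}) (eps : {lrmorphism L -> R}) (M : {vspace R}) :
    GRing.field_axiom D -> coprime (\dim {:L}) (\dim {:D}) ->
    (forall x, {in M, forall u, delta x * u \in M}) ->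
    (forall e, {in M, forall u, eps e * u \in M}) -> M != 0%VS ->
  (\dim {:D} * \dim {:L} <= \dim M)%N.
Proof.
move=> fieldD co stabD stabL M0; apply: dvdn_leq.
  by rewrite lt0n dimv_eq0.
rewrite Gauss_dvd 1?coprime_sym // (skew_submodule_dim fieldD stabD) /=.
by apply: (skew_submodule_dim _ stabL) => e; rewrite unitfE.
Qed.

End BaseChange.

(** * Algebra morphisms from functions *)

Section LRMorphisms.

Variable F : fieldType.

Lemma linfunE_linear (U W : vectType F) (f : U -> W) :
  linear f -> linfun f =1 f.
Proof.
move=> fL; pose fLm := GRing.isLinear.Build _ _ _ _ f fL.
by pose g : {linear U -> W} := HB.pack f fLm; apply: (lfunE g).
Qed.

Lemma lrmorphism_of (A B : falgType F) (f : A -> B) :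
  linear f -> monoid_morphism f -> exists g : {lrmorphism A -> B}, g =1 f.
Proof.
move=> fL fM; pose fLm := GRing.isLinear.Build _ _ _ _ f fL.
pose fMm := GRing.isMonoidMorphism.Build _ _ f fM.
by pose g : {lrmorphism A -> B} := HB.pack f fLm fMm; exists g.
Qed.

Lemma lrmorphism_into (A B : falgType F) (S : {aspace B}) (f : {lrmorphism A -> B}) :
    1 \in S -> (forall x, f x \in S) ->
  exists g : {lrmorphism A -> subvs_of S}, forall x, val (g x) = f x.
Proof.
move=> S1 fS; have [||g gE] := @lrmorphism_of A (subvs_of S) (fun x => Subvs (fS x)).
- by move=> k x y; apply: val_inj; rewrite /= linearP.
- split=> [|x y]; apply: val_inj; rewrite /= ?rmorphM // rmorph1.
  by apply/esym/eqP; rewrite algid_eq1.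
- by exists g => x; rewrite gE.
Qed.

End LRMorphisms.

(** * The tensor product of [D] and [L], with [t] extended to it *)

Section TensorProduct.

Variables (F : fieldType) (D : falgType F) (L : fieldExtType F).
Variable t : {lrmorphism L -> L}.
Hypothesis fieldD : GRing.field_axiom D.
Hypothesis co_dim : coprime (\dim {:L}) (\dim {:D}).
Variable d : nat.
Hypotheses (d_gt0 : (0 < d)%N) (td : forall e, iter d t e = e).

Local Notation V := 'Hom(L, D).

Fact hom_proper : (0 < dim V)%N.
Proof. by rewrite /dim /= muln_gt0 !FalgType_proper. Qed.

(* Products in [endV] are compositions in diagrammatic order. *)
Let endV_alg : algType F := lfun_algType hom_proper.
Let endV : falgType F := HB.pack 'End(V) endV_alg (Algebra_isFalgebra.Build F endV_alg).

Let postcomp (f : 'End(D)) : endV := linfun (fun u : V => (f \o u)%VF).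
Let precomp (f : 'End(L)) : endV := linfun (fun u : V => (u \o f)%VF).

Let postcompE f (u : V) : postcomp f u = (f \o u)%VF.
Proof.
by apply: linfunE_linear => k x y; rewrite comp_lfunDr -comp_lfunZr.
Qed.

Let precompE f (u : V) : precomp f u = (u \o f)%VF.
Proof.
by apply: linfunE_linear => k x y; rewrite comp_lfunDl -comp_lfunZl.
Qed.

Let endV_mulE (x y : endV) (u : V) : (x * y) u = y (x u).
Proof. exact: comp_lfunE. Qed.

Let endV_1E (u : V) : (1 : endV) u = u.
Proof. exact: id_lfunE. Qed.

(** The algebra is the endomorphism ring of [Hom(L, D)]. Elements of [D] act by postcomposition and
    those of [L] by precomposition, so they commute; precomposition with [t] gives [T], and
    conjugation by [T] extends [t]. *)
Lemma tensor_ambient : exists (B : falgType F) (delta : {lrmorphism D -> B})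
    (eps : {lrmorphism L -> B}) (T : B),
  [/\ forall x e, delta x * eps e = eps e * delta x,
      forall x, delta x * T = T * delta x,
      forall e, T * eps e = eps (t e) * T & T \is a GRing.unit].
Proof.
have [||delta deltaE] := @lrmorphism_of _ D endV (fun x => postcomp (amulr x)).
- move=> k x y; apply/lfunP => u; rewrite add_lfunE scale_lfunE !postcompE.
  by rewrite linearP comp_lfunDl -comp_lfunZl.
- split=> [|x y]; apply/lfunP => u.
    by rewrite postcompE endV_1E rmorph1; apply: comp_lfun1l.
  rewrite endV_mulE !postcompE comp_lfunA; congr (_ \o _)%VF.
  by apply/lfunP => v; rewrite comp_lfunE !lfunE /= mulrA.
have [||eps epsE] := @lrmorphism_of _ L endV (fun e => precomp (amulr e)).
- move=> k x y; apply/lfunP => u; rewrite add_lfunE scale_lfunE !precompE.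
  by rewrite linearP comp_lfunDr -comp_lfunZr.
- split=> [|x y]; apply/lfunP => u.
    by rewrite precompE endV_1E rmorph1; apply: comp_lfun1r.
  rewrite endV_mulE !precompE -comp_lfunA; congr (_ \o _)%VF.
  by apply/lfunP => v; rewrite comp_lfunE !lfunE /= mulrA mulrAC.
pose T := precomp (linfun t).
have TE i u v : (T ^+ i : endV) u v = u (iter i t v).
  elim: i u => [|i IHi] u; first by rewrite endV_1E.
  by rewrite exprS endV_mulE IHi precompE comp_lfunE lfunE.
exists endV, delta, eps, T; split.
- move=> x e; apply/lfunP => u; rewrite !endV_mulE deltaE epsE !postcompE !precompE.
  by rewrite comp_lfunA.
- move=> x; apply/lfunP => u; rewrite !endV_mulE deltaE !postcompE !precompE.
  by rewrite comp_lfunA.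
- move=> e; apply/lfunP => u; rewrite !endV_mulE !epsE !precompE.
  rewrite -!comp_lfunA; congr (_ \o _)%VF.
  by apply/lfunP => v; rewrite !comp_lfunE !lfunE /= rmorphM.
- have Td : T ^+ d = 1.
    by apply/lfunP => u; apply/lfunP => v; rewrite TE td endV_1E.
  by rewrite -(unitrX_pos _ d_gt0) Td unitr1.
Qed.

(** [R] is the product of the images of [D] and [L] inside the ambient algebra. The last clause
    serves as an induction principle: a linear condition on [R] need only be tested on products
    [delta x * eps e]. *)
Lemma base_change : exists (R : falgType F) (delta : {lrmorphism D -> R})
    (eps : {lrmorphism L -> R}) (tR : {lrmorphism R -> R}),
  [/\ GRing.field_axiom R, forall x e, delta x * eps e = eps e * delta x,
      forall x, tR (delta x) = delta x & forall e, tR (eps e) = eps (t e)]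
  /\ [/\ \dim {:R} = (\dim {:D} * \dim {:L})%N
      & forall W : {vspace R}, (forall x e, delta x * eps e \in W) -> W = fullv].
Proof.
have [B [delta [eps [T [comm deltaT epsT T_unit]]]]] := tensor_ambient.
pose U := limg (linfun delta); pose W := limg (linfun eps).
have memU x : delta x \in U by rewrite -[delta x](lfunE delta) memv_img ?memvf.
have memW e : eps e \in W by rewrite -[eps e](lfunE eps) memv_img ?memvf.
have UP u : u \in U -> exists x, u = delta x.
  by case/memv_imgP => x _ ->; exists x; rewrite lfunE.
have WP u : u \in W -> exists x, u = eps x.
  by case/memv_imgP => x _ ->; exists x; rewrite lfunE.
have UU : (U * U <= U)%VS.
  by apply/prodvP => _ _ /UP[x ->] /UP[y ->]; rewrite -rmorphM memU.
have WW : (W * W <= W)%VS.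
  by apply/prodvP => _ _ /WP[x ->] /WP[y ->]; rewrite -rmorphM memW.
have WU : (W * U <= U * W)%VS.
  by apply/prodvP => _ _ /WP[e ->] /UP[x ->]; rewrite -comm memv_mul.
have UW1 : 1 \in (U * W)%VS.
  by have := memv_mul (memU 1) (memW 1); rewrite !rmorph1 mulr1.
have UW_aspace : is_aspace (U * W).
  rewrite /is_aspace has_algid1 //=.
  have -> : (U * W * (U * W) = U * (W * U * W))%VS by rewrite !prodvA.
  apply: subv_trans (prodvSr U (prodvSl W WU)) _.
  have -> : (U * (U * W * W) = (U * U) * (W * W))%VS by rewrite !prodvA.
  exact: prodvS.
pose S := ASpace UW_aspace; have S1 : 1 \in S by [].
have memS x e : delta x * eps e \in S by rewrite memv_mul.
have [deltaR deltaRE] : exists g : {lrmorphism D -> subvs_of S},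
    forall x, val (g x) = delta x.
  by apply: lrmorphism_into => // x; have := memS x 1; rewrite rmorph1 mulr1.
have [epsR epsRE] : exists g : {lrmorphism L -> subvs_of S}, forall x, val (g x) = eps x.
  by apply: lrmorphism_into => // x; have := memS 1 x; rewrite rmorph1 mul1r.
have valM (x y : subvs_of S) : val (x * y) = val x * val y by [].
have [||tB tBE] := @lrmorphism_of _ (subvs_of S) B (fun x => T * vsval x * T^-1).
- by move=> k x y; rewrite /= mulrDr mulrDl -scalerAr -scalerAl.
- split=> [|x y]; last by rewrite /= !mulrA mulrVK.
  have -> : vsval (1 : subvs_of S) = 1 by apply/eqP; rewrite (algid_eq1 S).
  by rewrite mulr1 mulrV.
(* Conjugation by [T] fixes the image of [D] and stabilizes that of [L], hence stabilizes their
   product. *)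
have tBS x : tB x \in S.
  pose cT := (amulr (T^-1)%R \o amull T)%VF.
  suff /subvP sS : (S <= cT @^-1: S)%VS.
    have := sS _ (valP x); rewrite -memv_preim comp_lfunE !lfunE /= => ST.
    by rewrite tBE.
  apply/prodvP => _ _ /UP[x1 ->] /WP[e ->].
  rewrite -memv_preim comp_lfunE !lfunE /= mulrA -deltaT -!mulrA (mulrA T) epsT.
  by rewrite mulrK // memS.
have [tR tRE] := lrmorphism_into S1 tBS.
(* The upper bound holds for any product of subspaces; coprimality gives the lower bound. *)
have dimS : \dim S = (\dim {:D} * \dim {:L})%N.
  apply/eqP; rewrite eqn_leq; apply/andP; split.
    have limg_le (X : falgType F) (f : {lrmorphism X -> B}) :
        (\dim (limg (linfun f)) <= \dim {:X})%N.
      by rewrite -(limg_ker_dim (linfun f) {:X}) leq_addl.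
    by rewrite (leq_trans (dim_prodv _ _)) ?leq_mul ?limg_le.
  apply: (coprime_submodule_dim (delta := delta) (eps := eps)) => //.
  - move=> x u Su; rewrite memvM //; have := memS x 1; by rewrite rmorph1 mulr1.
  - move=> x u Su; rewrite memvM //; have := memS 1 x; by rewrite rmorph1 mul1r.
  - by apply/eqP => S0; have := S1; rewrite S0 memv0 oner_eq0.
have dimR : \dim {:subvs_of S} = (\dim {:D} * \dim {:L})%N.
  by rewrite dimvf -dimS.
exists (subvs_of S), deltaR, epsR, tR; split; split.
(* For [y != 0] the left ideal of multiples of [y] is stable under [D] and [L], hence is all of [R];
   so right multiplication by [y] is injective. *)
- apply: Falgebra_FieldMixin => x y xy0; apply/norP => -[x0 y0].
  pose M := limg (amulr y).
  have MP u : u \in M -> exists v, u = v * y.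
    by case/memv_imgP => v _ ->; exists v; rewrite lfunE.
  have memM v : v * y \in M.
    have -> : v * y = amulr y v by rewrite lfunE.
    by rewrite memv_img ?memvf.
  have Mf : M = fullv.
    apply/eqP; rewrite eqEdim subvf dimR.
    apply: (coprime_submodule_dim (delta := deltaR) (eps := epsR)) => //.
    + by move=> x1 _ /MP[v ->]; rewrite mulrA memM.
    + by move=> e _ /MP[v ->]; rewrite mulrA memM.
    + apply: contraNneq y0 => M0; have := memM 1.
      by rewrite M0 mul1r memv0.
  have ker0 : \dim (lker (amulr y)) = 0%N.
    have := limg_ker_dim (amulr y) fullv; rewrite -/M Mf capfv => /eqP.
    by rewrite -{2}[\dim fullv]add0n eqn_add2r => /eqP.
  have : x \in lker (amulr y) by rewrite memv_ker lfunE /= xy0.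
  by move/eqP: ker0; rewrite dimv_eq0 => /eqP->; rewrite memv0 (negPf x0).
- by move=> x e; apply: val_inj; rewrite !valM deltaRE epsRE comm.
- move=> x; apply: val_inj; rewrite tRE tBE deltaRE -deltaT.
  by rewrite mulrK.
- move=> e; apply: val_inj; rewrite tRE tBE !epsRE epsT.
  by rewrite mulrK.
- by [].
- move=> X SX; apply/eqP; rewrite eqEsubv subvf; apply/subvP => x _.
  suff /subvP sX : (S <= linfun vsval @: X)%VS.
    have /memv_imgP[x' Xx'] := sX _ (valP x).
    by rewrite lfunE => /val_inj->.
  apply/prodvP => _ _ /UP[x1 ->] /WP[e ->]; rewrite -deltaRE -epsRE -valM.
  have -> : val (deltaR x1 * epsR e) = linfun vsval (deltaR x1 * epsR e).
    by rewrite lfunE.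
  by rewrite memv_img.
Qed.

End TensorProduct.

(** * Symbol algebras *)

Section LinearAlgebra.

Variable F : fieldType.

Lemma linear_inj_surj (U W : vectType F) (f : U -> W) :
    linear f -> (forall u, f u = 0 -> u = 0) -> dim U = dim W ->
  forall w, exists u, w = f u.
Proof.
move=> fL fI dimUW w; have fE := linfunE_linear fL.
have ker0 : lker (linfun f) = 0%VS.
  apply/eqP; rewrite -subv0; apply/subvP => u; rewrite memv_ker fE memv0.
  by move/eqP/fI->.
have /memv_imgP[u _ ->] : w \in limg (linfun f).
  suff -> : limg (linfun f) = fullv by rewrite memvf.
  apply/eqP; rewrite eqEdim subvf limg_dim_eq; last by rewrite ker0 capv0.
  by rewrite !dimvf dimUW leqnn.
by exists u; rewrite fE.
Qed.

Lemma commutative_subalgebra_field (R : falgType F) (A : {aspace R}) :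
    GRing.field_axiom R -> {in A &, commutative *%R} ->
  exists (M : fieldExtType F) (h : {lrmorphism M -> R}),
    forall x, x \in A <-> exists m, x = h m.
Proof.
move=> fieldR comA.
have comS : commutative (@GRing.mul (subvs_of A)).
  by move=> x y; apply: val_inj; rewrite /= comA ?subvsP.
have A1 : algid A = 1 := skew_field_algid1 fieldR A.
pose comM := GRing.PzRing_hasCommutativeMul.Build (subvs_of A) comS.
pose S : comUnitRingType := HB.pack (subvs_of A) comM.
have fieldM : GRing.ComUnitRing_isField S.
  constructor => x x0; apply: vsval_unitr; apply: fieldR.
  by apply: contra x0 => /eqP x0; apply/eqP/val_inj.
pose M : fieldExtType F := HB.pack (subvs_of A) S fieldM.
have [||h hE] := @lrmorphism_of _ M R vsval.
- exact: linearP.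
- by split.
exists M, h => x; split=> [Ax | [m ->]]; last by rewrite hE subvsP.
by exists (Subvs Ax : subvs_of A); rewrite hE.
Qed.

End LinearAlgebra.

Section SymbolAlgebra.

Variables (F : fieldType) (L : fieldExtType F) (R : falgType F).
Variables (eps : {lrmorphism L -> R}) (q : nat) (zeta : L).
Hypothesis fieldR : GRing.field_axiom R.
Hypothesis eps_central : forall e x, eps e * x = x * eps e.
Hypotheses (zeta_prim : q.-primitive_root zeta) (q_neq0 : q%:R != 0 :> L).
Hypothesis dimR : \dim {:R} = (q ^ 2 * \dim {:L})%N.

Let q_gt0 : (0 < q)%N := prim_order_gt0 zeta_prim.

(** Eigenvectors of conjugation by [u] for distinct eigenvalues: conjugating the relation by each
    [u ^+ j] and inverting the discrete Fourier transform isolates [q] times each [x k]. *)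
Lemma eigen_indep (u : R) (x : 'I_q -> R) :
    u != 0 -> (forall i, u * x i = eps (zeta ^+ i) * x i * u) ->
    \sum_i x i = 0 ->
  forall i, x i = 0.
Proof.
move=> u0 ux sum0 k; have u_unit := fieldR u0.
have uX j i : u ^+ j * x i = eps (zeta ^+ (i * j)) * x i * u ^+ j.
  elim: j => [|j IHj]; first by rewrite muln0 rmorph1 !mul1r mulr1.
  rewrite exprS -mulrA IHj !mulrA -eps_central -[_ * u * x i]mulrA ux !mulrA.
  by rewrite -rmorphM -exprD -mulnSr -!mulrA.
have sumj (j : nat) : \sum_(i < q) eps (zeta ^+ (i * j)) * x i = 0.
  apply: (mulIr (unitrX j u_unit)); rewrite mul0r mulr_suml.
  under eq_bigr do rewrite -uX.
  by rewrite -mulr_sumr sum0 mulr0.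
have: \sum_(j < q) eps (zeta ^+ (q.-1 * k * j))
                  * \sum_(i < q) eps (zeta ^+ (i * j)) * x i = 0.
  by apply: big1 => j _; rewrite sumj mulr0.
under eq_bigr do rewrite mulr_sumr.
rewrite exchange_big /= (bigD1 k) //=.
have sumE (i : 'I_q) :
  \sum_(j < q) eps (zeta ^+ (q.-1 * k * j)) * (eps (zeta ^+ (i * j)) * x i)
    = (if i == k then q%:R else 0) * x i.
  under eq_bigr do rewrite mulrA -rmorphM -exprD -mulnDl addnC exprM.
  rewrite -mulr_suml -rmorph_sum /= prim_root_sum // eigen_exponent //.
  by case: ifP => _; rewrite ?rmorph0 ?rmorph_nat.
rewrite sumE eqxx big1 => [|i ik]; last by rewrite sumE (negPf ik) mul0r.
rewrite addr0 => qx0; apply: (mulrI (fieldR _) (etrans qx0 (esym (mulr0 _)))).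
by rewrite -(rmorph_nat eps) fmorph_eq0.
Qed.

Lemma symbol_expr (u v : R) i : u * v = eps zeta * v * u ->
  u * v ^+ i = eps (zeta ^+ i) * v ^+ i * u.
Proof.
move=> uv; elim: i => [|i IHi]; first by rewrite rmorph1 !mul1r mulr1.
rewrite [v ^+ _]exprSr mulrA IHi -mulrA uv !mulrA; congr (_ * _ * _).
by rewrite -[LHS]mulrA -eps_central mulrA -rmorphM -exprSr.
Qed.

(** The pair [v^-1], [u] satisfies the same relation, which lets the roles of the two generators be
    exchanged. *)
Lemma symbol_swap (u v : R) : v \is a GRing.unit -> u * v = eps zeta * v * u ->
  v^-1 * u = eps zeta * u * v^-1.
Proof.
move=> v_unit uv; apply: (mulrI v_unit); rewrite mulVKr //.
apply: (mulIr v_unit); rewrite uv -!mulrA mulVr // mulr1.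
by rewrite !mulrA eps_central.
Qed.

Lemma symbol_conj_commute (u v x : R) : v \is a GRing.unit ->
    u * v = eps zeta * v * u -> x * u = u * x ->
  v * x * v^-1 * u = u * (v * x * v^-1).
Proof.
move=> v_unit uv xu; rewrite -mulrA (symbol_swap v_unit uv) !mulrA uv.
by rewrite -[v * x * eps zeta]eps_central -!mulrA [x * (u * _)]mulrA xu -!mulrA.
Qed.

Variables u v : R.
Hypotheses (u_neq0 : u != 0) (v_neq0 : v != 0).
Hypothesis uv : u * v = eps zeta * v * u.

Let u_unit := fieldR u_neq0.
Let v_unit := fieldR v_neq0.

Lemma symbol_coef_indep (y : 'I_q -> R) :
    (forall j, u * y j = y j * u) -> \sum_j y j * v ^+ j = 0 ->
  forall j, y j = 0.
Proof.
move=> uy sum0 j.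
suff yv0 : y j * v ^+ j = 0.
  by apply: (mulIr (unitrX j v_unit)); rewrite yv0 mul0r.
apply: (eigen_indep u_neq0 (x := fun j => y j * v ^+ j)) => // i.
by rewrite mulrA uy -[LHS]mulrA (symbol_expr _ uv) !mulrA eps_central.
Qed.

(** Under conjugation by [v^-1] the powers of [u] are eigenvectors with distinct eigenvalues. *)
Lemma symbol_expr_indep (f : 'I_q -> L) :
  \sum_i eps (f i) * u ^+ i = 0 -> forall i, f i = 0.
Proof.
move=> sum0 i.
have fu0 : eps (f i) * u ^+ i = 0.
  apply: (eigen_indep (u := v^-1) (x := fun i => eps (f i) * u ^+ i)) => //.
    by apply: contraTneq v_unit => v0; rewrite -unitrV v0 unitr0.
  move=> j; rewrite mulrA -eps_central -mulrA symbol_expr ?symbol_swap //.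
  by rewrite !mulrA -!rmorphM [f j * _]mulrC.
apply/eqP; rewrite -(fmorph_eq0 eps); apply/eqP.
by apply: (mulIr (unitrX i u_unit)); rewrite fu0 mul0r.
Qed.

(** The monomials are independent over [L], and there are [q ^ 2] of them, which is all that [dimR]
    allows. *)
Lemma symbol_coef_exists x : exists f : 'I_q -> 'I_q -> L,
  x = \sum_j (\sum_i eps (f j i) * u ^+ i) * v ^+ j.
Proof.
pose Phi (f : {ffun 'I_q * 'I_q -> L}) :=
  \sum_j (\sum_i eps (f (j, i)) * u ^+ i) * v ^+ j.
have [||| f ->] := @linear_inj_surj _ {ffun 'I_q * 'I_q -> L} R Phi _ _ _ x.
- move=> k f1 f2; rewrite scaler_sumr -big_split; apply: eq_bigr => j _ /=.
  rewrite scalerAl scaler_sumr -mulrDl -big_split; congr (_ * _).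
  by apply: eq_bigr => i _; rewrite !ffunE linearP mulrDl -scalerAl.
- move=> f f0; apply/ffunP => -[j i]; rewrite ffunE.
  apply: (symbol_expr_indep (f := fun i => f (j, i))).
  apply: (symbol_coef_indep (y := fun j => \sum_i eps (f (j, i)) * u ^+ i)) => // k.
  rewrite mulr_sumr mulr_suml; apply: eq_bigr => l _.
  by rewrite mulrA -eps_central -!mulrA -exprS exprSr.
- by rewrite -[RHS]dimvf dimR {1}/dim /= card_prod card_ord dimvf.
by exists (fun j i => f (j, i)).
Qed.

(** Conjugation by [u] fixes [x] and scales the [j]-th term by [zeta ^+ j], so only the term of
    index [0] can survive. *)
Lemma symbol_coef0 (y : 'I_q -> R) x :
    (forall j, u * y j = y j * u) -> u * x = x * u -> x = \sum_j y j * v ^+ j ->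
  x = y (Ordinal q_gt0).
Proof.
move=> uy ux Dx; pose j0 := Ordinal q_gt0; apply/esym/eqP; rewrite -subr_eq0.
have := @eigen_indep u (fun j => y j * v ^+ j - if j == j0 then x else 0) u_neq0.
move=> /(_ _ _ j0); rewrite eqxx mulr1 => -> //.
  move=> j; rewrite !mulrBr mulrBl; congr (_ - _).
    by rewrite mulrA uy -[LHS]mulrA (symbol_expr _ uv) !mulrA eps_central.
  by case: (eqVneq j j0) => [->|_]; rewrite ?mulr0 ?mul0r // rmorph1 mul1r.
by rewrite big_split /= -Dx sumrN -big_mkcond big_pred1_eq subrr.
Qed.

Lemma symbol_centralizer x : u * x = x * u ->
  exists f : 'I_q -> L, x = \sum_i eps (f i) * u ^+ i.
Proof.
move=> ux; have [f Dx] := symbol_coef_exists x.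
exists (f (Ordinal q_gt0)).
apply: (symbol_coef0 (y := fun j => \sum_i eps (f j i) * u ^+ i)) => // j.
rewrite mulr_sumr mulr_suml; apply: eq_bigr => l _.
by rewrite mulrA -eps_central -!mulrA -exprS exprSr.
Qed.

End SymbolAlgebra.

(** * Cyclic algebras and cyclic extensions *)

Section LinearBijection.

Variables (F : fieldType) (U W : vectType F) (f : U -> W).
Hypothesis f_linear : linear f.

Lemma linear_bij :
  (forall u, f u = 0 -> u = 0) -> (forall w, exists u, w = f u) -> bijective f.
Proof.
move=> f_inj f_surj; have fE := linfunE_linear f_linear.
have ker0 : lker (linfun f) == 0%VS.
  rewrite -subv0; apply/subvP => u; rewrite memv_ker fE memv0.
  by move/eqP/f_inj->.
exists (linfun f)^-1%VF => [u | w]; first by rewrite -fE lker0_lfunK.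
by have [u ->] := f_surj w; rewrite -!fE lker0_lfunK.
Qed.

Lemma bij_linear_dim : bijective f -> dim U = dim W.
Proof.
case=> g fK gK; have fE := linfunE_linear f_linear.
have f0 : f 0 = 0 by rewrite -fE linear0.
have ker0 : lker (linfun f) = 0%VS.
  apply/eqP; rewrite -subv0; apply/subvP => u; rewrite memv_ker fE memv0.
  by move/eqP => fu0; rewrite -[u]fK fu0 -f0 fK.
have full : limg (linfun f) = fullv.
  apply/eqP; rewrite eqEsubv subvf; apply/subvP => w _.
  by rewrite -[w]gK -fE memv_img ?memvf.
by rewrite -!dimvf -full limg_dim_eq ?ker0 ?capv0.
Qed.

End LinearBijection.

Section CyclicAlgebra.

Variables (F : fieldType) (C : fieldExtType F) (D : falgType F).
Variables (h : {lrmorphism C -> D}) (x : D) (m : nat).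

Definition cyclic_sum (c : {ffun 'I_m -> C}) : D := \sum_(i < m) h (c i) * x ^+ i.

Lemma cyclic_sum_linear : linear cyclic_sum.
Proof.
move=> k c1 c2; rewrite /cyclic_sum scaler_sumr -big_split; apply: eq_bigr => i _.
by rewrite !ffunE linearP /= mulrDl -scalerAl.
Qed.

Lemma cyclic_sum_dim : bijective cyclic_sum -> (m * \dim {:C} = \dim {:D})%N.
Proof. by move/(bij_linear_dim cyclic_sum_linear); rewrite !dimvf /dim /= card_ord. Qed.

(** Scalars of [F] are particular coefficients in [C], so the powers of [x] below [m] are
    independent over [F]. *)
Lemma cyclic_sum_poly (P : {poly F}) :
  injective cyclic_sum -> (size P <= m)%N -> horner_alg x P = 0 -> P = 0.
Proof.
move=> inj szP Px0; pose c : {ffun 'I_m -> C} := [ffun i : 'I_m => (P`_i)%:A].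
have c0 : c = 0.
  apply: inj; transitivity (horner_alg x P).
    rewrite /horner_alg /horner_morph (horner_coef_wide _ (n := m)).
      apply: eq_bigr => i _; rewrite ffunE coef_map /=.
      by rewrite linearZ /= rmorph1.
    by rewrite (leq_trans (size_poly _ _)).
  by rewrite Px0 /cyclic_sum big1 // => i _; rewrite ffunE rmorph0 mul0r.
apply/polyP => i; rewrite coef0; have [lt_im | le_mi] := ltnP i m; last first.
  by rewrite nth_default // (leq_trans szP).
move/ffunP/(_ (Ordinal lt_im)): c0; rewrite !ffunE /= => /eqP.
by rewrite scaler_eq0 oner_eq0 orbF => /eqP.
Qed.

(** [A] and [B] come from factoring [Y ^+ p - c ^+ p] at [Y = 'X^k]. They have degrees [k] and
    [k * p.-1], both below [m], and a coefficient [1], so neither vanishes at [x], although their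
    product does. *)
Lemma cyclic_sum_not_power (p k : nat) (c : F) :
    GRing.field_axiom D -> bijective cyclic_sum -> (1 < p)%N -> (0 < k)%N ->
    m = (p * k)%N -> x ^+ m = (c ^+ p)%:A -> False.
Proof.
move=> fieldD /bij_inj inj p_gt1 k_gt0 Dm xm.
have evalX i : horner_alg x 'X^i = x ^+ i by rewrite rmorphXn /= horner_algX.
have evalC a : horner_alg x a%:P = a%:A by rewrite horner_algC.
pose A : {poly F} := 'X^k - c%:P.
pose B : {poly F} := \sum_(i < p) ('X^k) ^+ (p.-1 - i) * c%:P ^+ i.
have AB : horner_alg x A * horner_alg x B = 0.
  rewrite -rmorphM -subrXX rmorphB -exprM /= evalX mulnC -Dm xm.
  by rewrite -polyC_exp evalC subrr.
have Ak : A`_k = 1.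
  by rewrite coefB coefXn eqxx coefC gtn_eqF // subr0.
have szA : (size A <= m)%N.
  rewrite (leq_trans (size_polyD _ _)) // geq_max size_polyXn size_polyN.
  rewrite (leq_trans (size_polyC_leq1 _)) ?Dm ?muln_gt0 ?k_gt0 ?(ltnW p_gt1) //.
  rewrite -[k.+1]addn1 (leq_trans _ (leq_mul p_gt1 (leqnn k))) //.
  by rewrite mul2n -addnn leq_add2l.
have Bk : B`_(k * p.-1) = 1.
  rewrite coef_sum -(prednK (ltnW p_gt1)) big_ord_recl /= subn0 mulr1 -exprM.
  rewrite coefXn eqxx big1 ?addr0 // => i _.
  rewrite -exprM -polyC_exp coefMC coefXn eqn_mul2l gtn_eqF ?k_gt0 //=.
    by rewrite gtn_eqF ?mul0r // /bump /= add1n ltn_subrL (leq_ltn_trans _ (ltn_ord i)).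
have szB : (size B <= m)%N.
  apply: (leq_trans (size_sum _ _ _)); apply/bigmax_leqP => i _.
  rewrite -exprM -polyC_exp mulrC mul_polyC (leq_trans (size_scale_leq _ _)) //.
  rewrite size_polyXn Dm mulnC ltn_mul2r k_gt0 /=.
  by rewrite (leq_ltn_trans (leq_subr _ _)) // prednK // ltnW.
have [A0 | A0] := eqVneq (horner_alg x A) 0.
  move: Ak; rewrite (cyclic_sum_poly inj szA A0) coef0 => /esym/eqP.
  by rewrite oner_eq0.
have B0 : horner_alg x B = 0.
  by apply: (mulrI (fieldD _ A0)); rewrite AB mulr0.
move: Bk; rewrite (cyclic_sum_poly inj szB B0) coef0 => /esym/eqP.
by rewrite oner_eq0.
Qed.

End CyclicAlgebra.

(** The product of the factors ['X - (iter i s x)%:P] has coefficients fixed by [s], hence in [F],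
    so every minimal polynomial splits; Artin's theorem then gives the Galois group. [CS] is [C]
    with a richer structure, whence [f] is the identity. *)
Lemma cyclic_field_galois (F : fieldType) (C : fieldExtType F)
    (s : {lrmorphism C -> C}) (m : nat) :
    (0 < m)%N -> (forall c, iter m s c = c) ->
    (forall c, s c = c -> exists a : F, c = a%:A) ->
  exists (CS : splittingFieldType F) (f : {lrmorphism CS -> C}) (sigma : gal_of {:CS}),
    [/\ bijective f, galois 1 {:CS}, 'Gal({:CS} / 1)%g = <[sigma]>%g
      & forall c, s (f c) = f (sigma c)].
Proof.
case: m => // m _ sm s_fixed.
pose P x := \prod_(i < m.+1) ('X - (iter i s x)%:P).
have P_over1 x : P x \is a polyOver (1%VS : {vspace C}).
  have sP : map_poly s (P x) = P x.
    rewrite rmorph_prod /P; under eq_bigr do rewrite rmorphB /= map_polyX map_polyC.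
    rewrite big_ord_recr [RHS]big_ord_recl /= mulrC.
    by congr (('X - _%:P) * _); apply: sm.
  apply/polyOverP => i; apply/vlineP; apply: s_fixed.
  by rewrite -{2}sP coef_map.
have splitC : SplittingField.axiom C.
  apply: normal_field_splitting => K x.
  pose r := [seq iter i s x | i <- index_iota 0 m.+1].
  have Pr : P x = \prod_(y <- r) ('X - y%:P) by rewrite big_map big_mkord.
  have /dvdp_prod_XsubC[k splitK] : minPoly K x %| \prod_(y <- r) ('X - y%:P).
    rewrite -Pr minPoly_dvdp ?(polyOverSv (sub1v K)) // Pr root_prod_XsubC.
    by apply/mapP; exists 0%N; rewrite ?mem_index_iota.
  exists (mask k r).
  by rewrite -eqp_monic ?monic_prod_XsubC ?monic_minPoly.
pose splitM := FieldExt_isSplittingField.Build F C splitC.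
pose CS : splittingFieldType F := HB.pack (C : Type) C splitM.
pose sS : {lrmorphism CS -> CS} := s.
pose sigma := gal {:CS} (linfun_ahom sS).
have sigmaE c : sigma c = s c by rewrite galK ?subvf ?memvf // lfunE.
have fixed : fixedField <[sigma]>%g = 1%VS :> {vspace CS}.
  apply/eqP; rewrite eqEsubv sub1v andbT; apply/subvP => c /mem_fixedFieldP[_ fixc].
  by apply/vlineP; apply: s_fixed; rewrite -sigmaE fixc ?cycle_id.
exists CS, idfun, sigma; split=> //.
- by exists id.
- by have := fixedField_galois (<[sigma]>%g); rewrite fixed.
- by have := gal_fixedField (<[sigma]>%G); rewrite /= fixed.
- by move=> c; rewrite /= sigmaE.
Qed.

(** * Cyclotomic extensions *)

Lemma closed_field_prim_root (K : closedFieldType) (q : nat) :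
  (0 < q)%N -> q%:R != 0 :> K -> exists z : K, q.-primitive_root z.
Proof.
move=> q_gt0 q0; pose P : {poly K} := 'X^q - 1.
have [rs DP] := closed_field_poly_normal P.
rewrite (monicP _) ?monicXnsubC // scale1r in DP.
have rs1 : all q.-unity_root rs by apply/allP=> z; rewrite -root_prod_XsubC -DP.
have sz_rs : (q < (size rs).+1)%N.
  by rewrite -(size_prod_XsubC rs id) -DP size_XnsubC.
have [|z _ prim] := hasP (has_prim_root q_gt0 rs1 _ sz_rs); last by exists z.
by rewrite -separable_prod_XsubC -DP separable_Xn_sub_1.
Qed.

Lemma cyclotomic_field_presentation (q : nat) (F : fieldType) (K : closedFieldType)
    (iota : {rmorphism F -> K}) (d : nat) :
    (0 < q)%N -> q%:R != 0 :> F -> degree_over iota (adjoin iota (mu q)) d ->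
  exists (L : fieldExtType F) (zeta : L),
    [/\ q.-primitive_root zeta, <<1; zeta>>%VS = fullv & \dim {:L} = d].
Proof.
move=> q_gt0 q0 [L [j [j_alg jP dimL]]].
have [z prim] : exists z : K, q.-primitive_root z.
  by apply: closed_field_prim_root; rewrite // -(rmorph_nat iota) fmorph_eq0.
have [zeta Dz] : exists x, z = j x.
  by apply/jP => E _ muE; apply: muE; apply: prim_expr_order.
exists L, zeta; split=> //; first by rewrite Dz fmorph_primitive_root in prim.
(* The image of the field generated by [zeta] is a subfield over [F] containing all [q]-th roots of
   unity, so minimality of [adjoin] makes it everything. *)
pose E y := exists2 x, x \in <<1; zeta>>%AS & y = j x.
apply/eqP; rewrite eqEsubv subvf; apply/subvP => x _.
have [x1 Lx1 /fmorph_inj-> //] : E (j x).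
have /jP Ejx : exists y, j x = j y by exists x.
apply: Ejx => [|y yq]; last first.
  have [i ->] := prim_rootP prim yq; exists (zeta ^+ i); last by rewrite rmorphXn Dz.
  by rewrite rpredX ?memv_adjoin.
split=> [a | _ _ [x1 X1 ->] [x2 X2 ->] | _ _ [x1 X1 ->] [x2 X2 ->] | _ [x1 X1 ->]].
- by exists a%:A; rewrite ?j_alg // rpredZ ?rpred1.
- by exists (x1 - x2); rewrite ?rmorphB ?rpredB.
- by exists (x1 * x2); rewrite ?rmorphM ?rpredM.
- by exists x1^-1; rewrite ?fmorphV ?rpredV.
Qed.

Section Cyclotomic.

Lemma exp1D_square x j : exists y, ((1 + x) ^ j = 1 + j * x + x ^ 2 * y)%N.
Proof.
elim: j => [|j [y IHj]]; first by exists 0%N; rewrite muln0.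
exists (j + y + x * y)%N; rewrite expnS IHj.
by rewrite !mulnDl !mulnDr !mul1n !muln1 expnS expn1 mulSn; lia.
Qed.

(** Each [p]-th power gains one factor [p] in the distance to [1]. *)
Lemma expn_p_power_congr p a m :
  prime p -> a = 1 %[mod p] -> a ^ (p ^ m) = 1 %[mod p ^ m.+1].
Proof.
move=> p_prime a1; have p_gt1 := prime_gt1 p_prime.
suff [c ->] : exists c, (a ^ (p ^ m) = 1 + p ^ m.+1 * c)%N.
  by rewrite addnC mulnC modnMDl.
elim: m => [|m [c IHm]].
  exists (a %/ p)%N; rewrite !expn1 {1}(divn_eq a p) a1 modn_small //.
  by rewrite addnC mulnC.
rewrite expnSr expnM IHm; have [y ->] := exp1D_square (p ^ m.+1 * c) p.
exists (c + p ^ m * c ^ 2 * y)%N; rewrite -addnA; congr (_ + _)%N.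
by rewrite mulnDr [(p ^ m.+2)%N]expnS mulnA !expnS expn0; lia.
Qed.

(** [L] splits the separable polynomial ['X^q - 1], so it is Galois. Reducing the exponent of the
    action on [zeta] modulo [p] embeds the group in the units of ['F_p], which makes it cyclic. *)
Lemma cyclotomic_extension (p n : nat) (F : fieldType) (L : fieldExtType F) (zeta : L) :
    prime p -> (0 < n)%N -> (p ^ n).-primitive_root zeta ->
    <<1; zeta>>%VS = fullv -> ~~ (p %| \dim {:L})%N ->
  exists (t : {lrmorphism L -> L}) (r : nat),
    [/\ (0 < r)%N, coprime r (p ^ n), t zeta = zeta ^+ r,
        forall e, iter (\dim {:L}) t e = e
      & forall i, (0 < i < \dim {:L})%N -> zeta ^+ (r ^ i) != zeta]
    /\ forall e, t e = e -> exists a : F, e = a%:A.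
Proof.
move=> p_prime n_gt0 prim gen p_ndvd; set q := (p ^ n)%N in prim *.
have p_gt1 := prime_gt1 p_prime.
have q_gt0 := prim_order_gt0 prim; have zq := prim_expr_order prim.
pose rs := [seq zeta ^+ i | i <- index_iota 0 q].
have Xq1 : 'X^q - 1 = \prod_(x <- rs) ('X - x%:P).
  by rewrite -(factor_Xn_sub_1 prim) big_map.
have splitX : splittingFieldFor 1 ('X^q - 1) {:L}.
  exists rs; first by rewrite Xq1 eqpxx.
  apply/eqP; rewrite eqEsubv subvf -gen; apply/FadjoinP; split.
    exact: subv_adjoin_seq.
  by apply: seqv_sub_adjoin; apply/mapP; exists 1%N; rewrite ?mem_index_iota //
            (leq_trans p_gt1) // -{1}[p]expn1 leq_exp2l.
have overX : 'X^q - 1 \is a polyOver (1%VS : {vspace L}).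
  by rewrite rpredB ?rpredX ?polyOverX ?rpred1.
have axL : SplittingField.axiom L by exists ('X^q - 1).
pose splitM := FieldExt_isSplittingField.Build F L axL.
pose LS : splittingFieldType F := HB.pack (L : Type) L splitM.
have galL : galois 1 {:LS}.
  apply/splitting_galoisField; exists ('X^q - 1); split=> //.
  rewrite Xq1 separable_prod_XsubC map_inj_in_uniq ?iota_uniq //.
  move=> i j; rewrite !mem_index_iota /= => iq jq /eqP.
  by rewrite (eq_prim_root_expr prim) !modn_small // => /eqP.
have cardG : #|'Gal({:LS} / 1)%g| = \dim {:L}.
  by rewrite -galois_dim // dimv1 divn1.
have galX (x : gal_of {:LS}) i e : iter i x e = (x ^+ i)%g e.
  elim: i => [|i IHi]; first by rewrite gal_id.
  by rewrite expgSr galM ?memvf //= IHi.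
have gal_eq1 (x : gal_of {:LS}) : x zeta = zeta -> x = 1%g.
  move=> xz; apply/eqP/gal_eqP => e; rewrite gal_id => _.
  have : e \in (<<1; zeta>>%VS : {vspace L}) by rewrite gen memvf.
  case/Fadjoin_polyP => P /polyOver1P[Q ->] ->.
  rewrite -horner_map /= xz; congr _.[_]; rewrite -map_poly_comp.
  by apply: eq_map_poly => a /=; rewrite rmorph_alg.
have kP (x : gal_of {:LS}) : {k : nat | x zeta = zeta ^+ k}.
  exact: (aut_unity_rootP x q_gt0 zq).
pose k x := sval (kP x); have kE (x : gal_of {:LS}) : x zeta = zeta ^+ k x := svalP (kP x).
have k_eq (x : gal_of {:LS}) i : x zeta = zeta ^+ i -> k x = i %[mod q].
  by rewrite kE => /eqP; rewrite (eq_prim_root_expr prim) => /eqP.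
have iterz (x : gal_of {:LS}) j : iter j x zeta = zeta ^+ (k x ^ j).
  elim: j => [|j IHj]; first by rewrite expr1.
  by rewrite iterS IHj rmorphXn /= kE -exprM expnS.
have p_dvd_q : (p %| q)%N by rewrite dvdn_exp.
have kp x i : k x = i %[mod q] -> (k x)%:R = i%:R :> 'F_p.
  move=> E; apply: val_inj; rewrite /= !val_Fp_nat //.
  by rewrite -(modn_dvdm _ p_dvd_q) E modn_dvdm.
have cycG : cyclic 'Gal({:LS} / 1)%g.
  apply: (@field_mul_group_cyclic _ _ 'F_p (fun x => (k x)%:R)) => [x y _ _ | x Gx].
    rewrite -natrM; apply: kp; apply: k_eq.
    by rewrite galM ?memvf // kE rmorphXn /= kE -exprM mulnC.
  split=> [kx1 | ->]; last by apply: (kp _ 1%N); apply: k_eq; rewrite gal_id.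
  have {}kx1 : k x = 1 %[mod p].
    have : (k x)%:R == 1%:R :> 'F_p by rewrite kx1.
    by rewrite -val_eqE /= val_Fp_nat // Fp_cast // => /eqP.
  (* An automorphism with exponent [1] modulo [p] has [p]-power order; the group order is prime to
     [p], so it is trivial. *)
  have xp : (x ^+ (p ^ n.-1) = 1)%g.
    apply: gal_eq1; rewrite -galX.
    rewrite iterz; apply/eqP; rewrite -[X in _ == X]expr1 (eq_prim_root_expr prim) /q.
    rewrite -[n]prednK //; apply/eqP; exact: expn_p_power_congr.
  apply/eqP; rewrite -order_eq1 -dvdn1.
  have /eqP <- : coprime (p ^ n.-1) #|'Gal({:LS} / 1)%g|.
    by rewrite coprimeXl // prime_coprime // cardG.
  by rewrite dvdn_gcd order_dvdG // order_dvdn xp eqxx.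
have [t Dt] := cyclicP cycG.
have ordt : #[t]%g = \dim {:L} by rewrite -cardG Dt.
have tr := kE t.
have prim_r : q.-primitive_root (zeta ^+ k t) by rewrite -tr fmorph_primitive_root.
have co_r : coprime (k t) q by rewrite -(prim_root_exp_coprime _ prim).
exists (gal_repr t : {lrmorphism LS -> LS}), (k t); split; first split=> //.
- rewrite lt0n; apply: contraTneq co_r => ->; rewrite /coprime gcd0n.
  by rewrite gtn_eqF // -{1}(exp1n n) ltn_exp2r.
- by move=> e; rewrite galX -ordt expg_order gal_id.
- move=> i /andP[i_gt0 i_lt]; apply: contraTneq i_lt => zi; rewrite -leqNgt.
  rewrite -ordt dvdn_leq // order_dvdn; apply/eqP; apply: gal_eq1.
  by rewrite -galX iterz.
- move=> e te.
  have : (e : LS) \in fixedField 'Gal({:LS} / 1)%g.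
    apply/fixedFieldP=> [|x]; first exact: memvf.
    by rewrite Dt => /cycleP[i ->]; rewrite -galX iter_fix.
  by have /galois_fixedField -> := galL; move/vlineP.
Qed.

End Cyclotomic.

(** * Descent of the equivariant eigenvector *)

Lemma lrmorphism_lift (F : fieldType) (M : fieldExtType F) (R X : falgType F)
    (h : {lrmorphism M -> R}) (f : {lrmorphism X -> R}) :
    (forall x, exists m, f x = h m) ->
  exists f' : {lrmorphism X -> M}, forall x, h (f' x) = f x.
Proof.
move=> f_in.
have ker0 : lker (linfun h) == 0%VS.
  rewrite -subv0; apply/subvP => u; rewrite memv_ker lfunE memv0 /=.
  by rewrite fmorph_eq0.
pose f0 x := ((linfun h)^-1)%VF (f x).
have f0E x : h (f0 x) = f x.
  have [u fx] := f_in x; rewrite /f0 fx -[h u](lfunE h) lker0_lfunK //.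
  by rewrite lfunE.
have [||f' f'E] := @lrmorphism_of F X M f0.
- by move=> k x y; rewrite /f0 !linearP.
- by split=> [|x y]; apply: (fmorph_inj h); rewrite ?rmorphM /= !f0E ?rmorphM // !rmorph1.
- by exists f' => x; rewrite f'E f0E.
Qed.

Lemma conjugation_lrmorphism (F : fieldType) (X R : falgType F)
    (f : {lrmorphism X -> R}) (u : R) : u \is a GRing.unit ->
  exists f' : {lrmorphism X -> R}, forall x, f' x = u * f x * u^-1.
Proof.
move=> Uu; have [||f' f'E] := @lrmorphism_of F X R (fun x => u * f x * u^-1).
- by move=> k x y; rewrite linearP mulrDr mulrDl -scalerAr -scalerAl.
- split=> [|x y]; first by rewrite rmorph1 mulr1 mulrV.
  by rewrite rmorphM !mulrA mulrVK.
- by exists f'.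
Qed.

(** * Fixed points of [tR]: Galois descent from [R] to [D] *)

Section TensorFixedPoints.

Variables (F : fieldType) (D : falgType F) (L : fieldExtType F) (R : falgType F).
Variables (delta : {lrmorphism D -> R}) (eps : {lrmorphism L -> R}).
Variables (t : {lrmorphism L -> L}) (tR : {lrmorphism R -> R}).
Variables (q r d : nat) (zeta : L).
Hypotheses (zeta_prim : q.-primitive_root zeta) (q_neq0 : q%:R != 0 :> L).
Hypotheses (r_gt0 : (0 < r)%N) (t_zeta : t zeta = zeta ^+ r).
Hypotheses (d_gt0 : (0 < d)%N) (td : forall e, iter d t e = e).
Hypothesis r_order : forall i, (0 < i < d)%N -> zeta ^+ (r ^ i) != zeta.
Hypothesis t_fixed : forall e, t e = e -> exists a : F, e = a%:A.
Hypothesis comm : forall x e, delta x * eps e = eps e * delta x.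
Hypothesis tR_delta : forall x, tR (delta x) = delta x.
Hypothesis tR_eps : forall e, tR (eps e) = eps (t e).
Hypothesis gen : forall W : {vspace R},
  (forall x e, delta x * eps e \in W) -> W = fullv.

Lemma eps_central e y : eps e * y = y * eps e.
Proof.
apply/cent1vP; rewrite cent1vC (gen (W := 'C[eps e]%VS)) ?memvf // => x e'.
by apply/cent1vP; rewrite -mulrA -rmorphM mulrC rmorphM !mulrA comm.
Qed.

Lemma tR_order y : iter d tR y = y.
Proof.
pose f u := iter d tR u - u.
have fL : linear f.
  move=> k u v; rewrite /f scalerBr addrACA -opprD; congr (_ - _).
  by elim: d => //= j ->; rewrite linearP.
have kerf : lker (linfun f) = fullv.
  apply: gen => x e; rewrite memv_ker linfunE_linear // subr_eq0; apply/eqP.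
  rewrite rmorphM; congr (_ * _); first by apply: iter_fix; rewrite /= tR_delta.
  rewrite -[in RHS](td e); elim: d => //= j ->.
  exact: tR_eps.
have : y \in lker (linfun f) by rewrite kerf memvf.
by rewrite memv_ker linfunE_linear // subr_eq0 => /eqP.
Qed.

(** The trace of [L] over [F]. *)
Let tr e := \sum_(i < d) iter i t e.

Let tr_scalar e : exists a : F, tr e = a%:A.
Proof.
apply: t_fixed; rewrite /tr rmorph_sum /=.
case: d d_gt0 td => // k _ tk.
rewrite big_ord_recr [RHS]big_ord_recl /= addrC; congr (_ + _); exact: tk.
Qed.

Let tr_neq0 : exists e, tr e != 0.
Proof.
have iterz i : iter i t zeta = zeta ^+ (r ^ i).
  elim: i => [|i IHi]; first by rewrite expr1.
  by rewrite iterS IHi rmorphXn /= t_zeta -exprM expnS.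
have sumq : \sum_(j < q) zeta ^- j * tr (zeta ^+ j) = q%:R.
  under eq_bigr do rewrite mulr_sumr.
  rewrite exchange_big /= (bigD1 (Ordinal d_gt0)) //= [X in _ + X]big1 ?addr0.
    by have := prim_root_dual zeta_prim (ltn0Sn 0); rewrite expr1 eqxx => <-.
  move=> i i0; under eq_bigr do rewrite rmorphXn /= iterz.
  rewrite prim_root_dual // ?expn_gt0 ?r_gt0 // (negPf (r_order _)) //.
  by rewrite ltn_ord andbT lt0n.
case: (pickP (fun j : 'I_q => tr (zeta ^+ j) != 0)) => [j trj | tr0].
  by exists (zeta ^+ j).
case/eqP: q_neq0; rewrite -sumq big1 // => j _.
by have /negbFE/eqP-> := tr0 j; rewrite mulr0.
Qed.

(** The map [f] is a trace preceded by multiplication by [e]. It sends [R] into the image of [D],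
    and multiplies a fixed [y] by the non-zero scalar [tr e]. *)
Lemma tensor_fixed y : tR y = y -> exists x, y = delta x.
Proof.
move=> ty; have [e tre] := tr_neq0; have [a Da] := tr_scalar e.
pose f u := \sum_(i < d) iter i tR (eps e * u).
have fL : linear f.
  move=> k u v; rewrite scaler_sumr -big_split; apply: eq_bigr => i _ /=.
  rewrite mulrDr -scalerAr; elim: (val i) => //= j ->.
  by rewrite linearP.
have iterR i x e' : iter i tR (eps e' * delta x) = eps (iter i t e') * delta x.
  by elim: i => //= i ->; rewrite rmorphM /= tR_eps tR_delta.
have fE u x : f (delta x * eps u) = eps (tr (e * u)) * delta x.
  rewrite /tr rmorph_sum mulr_suml; apply: eq_bigr => i _.
  by rewrite comm mulrA -rmorphM iterR.
pose W := (linfun f @^-1: limg (linfun delta))%VS.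
have Wf : W = fullv.
  apply: gen => x u; rewrite -memv_preim linfunE_linear // fE.
  have [b ->] := tr_scalar (e * u).
  rewrite linearZ /= rmorph1 mulr_algl memvZ // -[delta x](lfunE delta).
  by rewrite memv_img ?memvf.
have : y \in W by rewrite Wf memvf.
rewrite -memv_preim linfunE_linear // => /memv_imgP[x _]; rewrite lfunE /= => fy.
have fy1 : f y = a *: y.
  have iterRy i e' : iter i tR (eps e' * y) = eps (iter i t e') * y.
    by elim: i => //= i ->; rewrite rmorphM /= tR_eps ty.
  rewrite /f; under eq_bigr do rewrite iterRy.
  by rewrite -mulr_suml -rmorph_sum /= -/(tr e) Da linearZ /= rmorph1 mulr_algl.
have a0 : a != 0 by apply: contraNneq tre => a0; rewrite Da a0 scale0r.
exists (a^-1 *: x); rewrite linearZ /= -fy fy1 scalerA mulVf ?scale1r //.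
Qed.

End TensorFixedPoints.

(** * An eigenvector for conjugation by [g] *)

Section Eigenvector.

Variables (F : fieldType) (L : fieldExtType F) (R : falgType F).
Variables (eps : {lrmorphism L -> R}) (p n : nat) (zeta : L) (g x : R).
Let q := (p ^ n)%N.
Hypothesis fieldR : GRing.field_axiom R.
Hypothesis eps_central : forall e y, eps e * y = y * eps e.
Hypotheses (p_prime : prime p) (n_gt0 : (0 < n)%N).
Hypotheses (zeta_prim : q.-primitive_root zeta) (q_neq0 : q%:R != 0 :> L).
Hypotheses (g_neq0 : g != 0) (gq_central : forall y, g ^+ q * y = y * g ^+ q).
Hypothesis gx : g ^+ (p ^ n.-1) * x != x * g ^+ (p ^ n.-1).

(* The resolvents of [x] under conjugation by [g] are eigenvectors summing to
   [q * x]; one of them does not commute with [g ^+ (p ^ n.-1)], so its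
   eigenvalue is a primitive [q]-th root of unity. *)
Lemma eigenvector_exists : exists2 z, z != 0 & g * z = eps zeta * z * g.
Proof.
have g_unit := fieldR g_neq0; have q_gt0 := prim_order_gt0 zeta_prim.
have zq := prim_expr_order zeta_prim.
pose f i j := eps (zeta ^+ (q.-1 * i * j)) * (g ^+ j * x * g ^- j).
have fS i j : g * f i j = eps (zeta ^+ i) * f i j.+1 * g.
  have ze : zeta ^+ i * zeta ^+ (q.-1 * i * j.+1) = zeta ^+ (q.-1 * i * j).
    by rewrite -exprD mulnS addnA -mulSn prednK // exprD exprM zq expr1n mul1r.
  rewrite /f !mulrA -rmorphM ze -[g * eps _]eps_central exprS.
  by rewrite invrM ?unitrX // !mulrA mulrVK.
(* Centrality of [g ^+ q] makes the summands periodic, so the shift in [fS] only permutes them. *)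
have fq i : f i q = f i 0%N.
  rewrite /f muln0 mulnC exprM zq expr1n gq_central mulrK ?unitrX //.
  by rewrite !mul1r invr1 mulr1.
pose X (i : nat) := \sum_(j < q) f i j.
have gX i : g * X i = eps (zeta ^+ i) * X i * g.
  rewrite mulr_sumr; under eq_bigr do rewrite fS.
  rewrite -mulr_suml -mulr_sumr; congr (_ * _ * _).
  rewrite /X; case: (q) (fq i) => [|k] fk; first by rewrite !big_ord0.
  by rewrite big_ord_recr [RHS]big_ord_recl /= addrC fk.
have gkX i k : g ^+ k * X i = eps (zeta ^+ (i * k)) * X i * g ^+ k.
  elim: k => [|k IHk]; first by rewrite muln0 rmorph1 !mul1r mulr1.
  rewrite exprS -mulrA IHk !mulrA -eps_central -[_ * g * X i]mulrA gX !mulrA.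
  by rewrite -rmorphM -exprD -mulnSr -!mulrA -exprS.
have sumX : \sum_(i < q) X i = q%:R * x.
  rewrite /X exchange_big /= (bigD1 (Ordinal q_gt0)) //= [X in _ + X]big1 ?addr0.
    under eq_bigr do rewrite /f muln0 rmorph1 mul1r expr0 mul1r invr1 mulr1.
    by rewrite sumr_const card_ord mulr_natl.
  move=> j j0; rewrite -mulr_suml -rmorph_sum.
  under eq_bigr do rewrite mulnAC exprM.
  rewrite prim_root_sum // Gauss_dvdr.
    by rewrite /dvdn modn_small // -val_eqE /= in j0 *; rewrite (negPf j0) rmorph0 mul0r.
  by rewrite coprime_sym coprimePn.
have := gx; set k := (p ^ n.-1)%N => gkx.
case: (pickP (fun i : 'I_q => g ^+ k * X i != X i * g ^+ k)) => [i gXi | comX]; last first.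
  case/eqP: gkx; apply: (mulrI (fieldR (_ : q%:R != 0))).
    by rewrite -(rmorph_nat eps) fmorph_eq0.
  rewrite [RHS]mulrA -sumX [LHS]mulr_natl -mulrnAr -[x *+ q]mulr_natl -sumX.
  rewrite mulr_sumr mulr_suml.
  by apply: eq_bigr => i _; have /negbFE/eqP := comX i.
have Xi0 : X i != 0 by apply: contraNneq gXi => ->; rewrite mulr0 mul0r.
(* If [p] divided [i], the eigenvalue [zeta ^+ (i * k)] would be [1] and [X i] would commute with
   [g ^+ k]. *)
have co_ip : coprime i q.
  rewrite coprimeXr // coprime_sym prime_coprime //.
  apply: contra gXi => /dvdnP[c Di]; rewrite gkX Di.
  rewrite -mulnA -expnS prednK // mulnC exprM zq expr1n rmorph1 mul1r //.
have i_gt0 : (0 < i)%N.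
  rewrite lt0n; apply: contraNneq gXi => i0.
  by rewrite gkX i0 mul0n rmorph1 mul1r.
have [s [c Ds]] := coprime_mul_inv i_gt0 co_ip.
(* As [s] inverts [i] modulo [q], the eigenvalue [zeta ^+ i] becomes [zeta]. *)
exists (X i ^+ s).
  by apply: contraTneq (unitrX s (fieldR Xi0)) => ->; rewrite unitr0.
by rewrite (symbol_expr eps_central s (gX i)) -exprM mulnC Ds exprD exprM zq expr1n mul1r.
Qed.

End Eigenvector.

(** * Making the eigenvector compatible with [tR] *)

Section EquivariantEigenvector.

Variables (F : fieldType) (L : fieldExtType F) (R : falgType F).
Variables (eps : {lrmorphism L -> R}) (t : {lrmorphism L -> L}) (tR : {lrmorphism R -> R}).
Variables (q r d : nat) (zeta : L) (a : F) (g : R).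
Hypothesis fieldR : GRing.field_axiom R.
Hypothesis eps_centr : forall e y, eps e * y = y * eps e.
Hypotheses (zeta_prim : q.-primitive_root zeta) (q_neq0 : q%:R != 0 :> L).
Hypotheses (r_gt0 : (0 < r)%N) (t_zeta : t zeta = zeta ^+ r).
Hypotheses (d_gt0 : (0 < d)%N) (td : forall e, iter d t e = e).
Hypothesis r_order : forall i, (0 < i < d)%N -> zeta ^+ (r ^ i) != zeta.
Hypotheses (co_dq : coprime d q) (co_rq : coprime r q).
Hypotheses (tR_eps : forall e, tR (eps e) = eps (t e)) (tRd : forall y, iter d tR y = y).
Hypothesis dimR : \dim {:R} = (q ^ 2 * \dim {:L})%N.
Hypotheses (g_neq0 : g != 0) (gq : g ^+ q = a%:A) (tR_g : tR g = g).

Lemma eps_comb_comm (f : 'I_q -> L) (u y : R) : u * y = y * u ->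
  (\sum_i eps (f i) * u ^+ i) * y = y * \sum_i eps (f i) * u ^+ i.
Proof.
move=> uy; rewrite mulr_suml mulr_sumr; apply: eq_bigr => i _.
rewrite -[LHS]mulrA [RHS]mulrA -eps_centr -[RHS]mulrA; congr (_ * _).
exact/commr_sym/commrX/commr_sym.
Qed.

Lemma equivariant_eigenvector (z : R) : z != 0 -> g * z = eps zeta * z * g ->
  exists w b e, [/\ w != 0, g * w = eps zeta * w * g, w ^+ q = eps b
                  & tR w = eps e * w ^+ r].
Proof.
move=> z_neq0 gz; have z_unit := fieldR z_neq0; have g_unit := fieldR g_neq0.
have cent_g := symbol_centralizer fieldR eps_centr zeta_prim q_neq0 dimR g_neq0 z_neq0 gz.
have comA : {in 'C[g]%AS &, commutative *%R}.
  move=> x y /cent1vP xg /cent1vP yg; have [f ->] := cent_g x (esym xg).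
  exact: eps_comb_comm.
have [M [h hP]] := commutative_subalgebra_field fieldR comA.
have h_g m : h m * g = g * h m by apply/cent1vP/hP; exists m.
have in_h y : y * g = g * y -> exists m, y = h m by move=> yg; apply/hP/cent1vP.
have [epsM epsME] : exists f' : {lrmorphism L -> M}, forall e, h (f' e) = eps e.
  by apply: lrmorphism_lift => e; apply: in_h; rewrite eps_centr.
have [gM hgM] := in_h g erefl.
have [cz czE] := conjugation_lrmorphism h z_unit.
have [sg sgE] : exists f' : {lrmorphism M -> M}, forall m, h (f' m) = cz m.
  apply: lrmorphism_lift => m; apply: in_h.
  by rewrite czE (symbol_conj_commute eps_centr z_unit gz).
have [tM tME] : exists f' : {lrmorphism M -> M}, forall m, h (f' m) = (tR \o h) m.
  apply: (@lrmorphism_lift _ _ _ M h (tR \o h)) => m; apply: in_h => /=.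
  by rewrite -{1}tR_g -rmorphM h_g rmorphM /= tR_g.
have zE m : z * h m = h (sg m) * z by rewrite sgE czE mulrVK.
have sg_eps e : sg (epsM e) = epsM e.
  by apply: (fmorph_inj h); rewrite /= sgE czE epsME -eps_centr mulrK.
have tM_eps e : tM (epsM e) = epsM (t e).
  by apply: (fmorph_inj h); rewrite /= tME /= !epsME tR_eps.
have tM_g : tM gM = gM.
  by apply: (fmorph_inj h); rewrite /= tME /=; have := tR_g; rewrite hgM.
have gM_neq0 : gM != 0 by rewrite -(fmorph_eq0 h) /= -hgM.
have gMq : gM ^+ q = epsM a%:A.
  by apply: (fmorph_inj h); rewrite rmorphXn /= -hgM gq epsME linearZ /= rmorph1.
have sg_g : epsM zeta * sg gM = gM.
  apply: (fmorph_inj h); rewrite rmorphM /= epsME sgE czE -hgM !mulrA -gz.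
  by rewrite mulrK.
have M_gen m : exists f : 'I_q -> L, m = \sum_(i < q) epsM (f i) * gM ^+ i.
  have [f Dm] := cent_g (h m) (esym (h_g m)); exists f.
  apply: (fmorph_inj h); rewrite /= Dm rmorph_sum; apply: eq_bigr => i _.
  by rewrite rmorphM rmorphXn /= epsME -hgM.
have zq_cent : z ^+ q * g = g * z ^+ q.
  by rewrite (symbol_expr eps_centr _ gz) (prim_expr_order zeta_prim) rmorph1 mul1r.
(* The power [z ^+ q] lies in the centralizer [M] of [g] and commutes with [z], so it is fixed by
   [sg]. *)
have [b zq] : exists b, z ^+ q = h (epsM b).
  have [m Dm] := in_h _ zq_cent; have sgm : sg m = m.
    by apply: (fmorph_inj h); rewrite /= sgE czE -Dm -exprS exprSr mulrK.
  have [b Db] := sg_fixed zeta_prim q_neq0 sg_g sg_eps M_gen sgm.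
  by exists b; rewrite Dm Db.
have gtz : g * tR z = eps (zeta ^+ r) * tR z * g.
  by rewrite -{1}tR_g -rmorphM gz !rmorphM /= tR_g tR_eps t_zeta.
have gzr := symbol_expr eps_centr r gz.
(* Both [tR z] and [z ^+ r] are eigenvectors for [zeta ^+ r], so their quotient commutes with
   [g]. *)
have [k tRz] : exists k, tR z = h k * z ^+ r.
  have [|k Dk] := in_h (tR z * z ^- r); last first.
    by exists k; rewrite -Dk divrK ?unitrX.
  have swap := symbol_swap eps_centr (unitrX r z_unit) gzr.
  by rewrite -mulrA swap !mulrA -eps_centr gtz.
have [x [b' [e]]] := equivariant_conjugator zeta_prim q_neq0 gM_neq0 gMq sg_g sg_eps M_gen
  tM_g tM_eps td t_zeta r_order d_gt0 r_gt0 co_dq co_rq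
  (fun m => esym (tME m)) tRd z_unit zE zq tRz.
rewrite /= !epsME => -[x_neq0 wq tRw].
exists (h x * z), b', e; split.
- apply: contraNneq x_neq0 => /(canRL (mulrK z_unit)); rewrite mul0r => /eqP.
  by rewrite fmorph_eq0.
- by rewrite mulrA -h_g -mulrA gz !mulrA eps_centr.
- by [].
- by [].
Qed.

End EquivariantEigenvector.

(** * The cyclic maximal subfield of [D] *)

Section CyclicDescent.

Variables (F : fieldType) (D : falgType F) (L : fieldExtType F) (R : falgType F).
Variables (delta : {lrmorphism D -> R}) (eps : {lrmorphism L -> R}).
Variables (tR : {lrmorphism R -> R}).
Variables (q r : nat) (zeta : L) (a : F) (gamma : D) (w : R) (b e : L).
Let g := delta gamma.
Hypotheses (fieldD : GRing.field_axiom D) (fieldR : GRing.field_axiom R).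
Hypothesis centerD : ('Z({:D}) = 1)%VS.
Hypothesis eps_centr : forall e' y, eps e' * y = y * eps e'.
Hypotheses (zeta_prim : q.-primitive_root zeta) (q_neq0 : q%:R != 0 :> L).
Hypotheses (r_gt0 : (0 < r)%N) (co_rq : coprime r q).
Hypothesis tR_delta : forall x, tR (delta x) = delta x.
Hypothesis tR_fixed : forall y, tR y = y -> exists x, y = delta x.
Hypotheses (dimD : \dim {:D} = (q ^ 2)%N) (dimR : \dim {:R} = (q ^ 2 * \dim {:L})%N).
Hypotheses (a_neq0 : a != 0) (gamma_q : gamma ^+ q = a%:A).
Hypotheses (w_neq0 : w != 0) (gw : g * w = eps zeta * w * g).
Hypotheses (wq : w ^+ q = eps b) (tR_w : tR w = eps e * w ^+ r).

Lemma cyclic_of_equivariant_eigenvector : is_cyclic_algebra D.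
Proof.
have q_gt0 := prim_order_gt0 zeta_prim.
have gamma_neq0 : gamma != 0.
  apply: contraNneq a_neq0 => g0; move: gamma_q; rewrite g0 expr0n gtn_eqF //=.
  by move/esym/eqP; rewrite scaler_eq0 oner_eq0 orbF.
have gamma_unit := fieldD gamma_neq0; have w_unit := fieldR w_neq0.
have g_unit : g \is a GRing.unit by rewrite rmorph_unit.
have g_neq0 : g != 0 by apply: contraTneq g_unit => ->; rewrite unitr0.
have delta_inj : injective delta := skew_field_rmorph_inj fieldD.
(* This is the inverse of [zeta]: the symbol pair is now read as [w], [g], with coefficients in the
   centralizer of [w]. *)
pose zeta' := zeta ^+ q.-1.
have zeta'_prim : q.-primitive_root zeta'.
  by rewrite prim_root_exp_coprime // coprime_sym coprimenP.
have wg : w * g = eps zeta' * g * w.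
  rewrite -mulrA gw !mulrA -rmorphM -exprSr prednK // (prim_expr_order zeta_prim).
  by rewrite rmorph1 mul1r.
have cent_w := symbol_centralizer fieldR eps_centr zeta'_prim q_neq0 dimR
  w_neq0 g_neq0 wg.
pose V := (linfun delta @^-1: 'C[w])%VS.
have VP x : reflect (delta x * w = w * delta x) (x \in V).
  by rewrite -memv_preim lfunE; apply: cent1vP.
have V_aspace : is_aspace V.
  rewrite /is_aspace has_algid1; last by apply/VP; rewrite rmorph1 mul1r mulr1.
  apply/prodvP => x y /VP xw /VP yw; apply/VP.
  by rewrite rmorphM -mulrA yw !mulrA xw.
have comV : {in ASpace V_aspace &, commutative *%R}.
  move=> x y /VP xw /VP yw; apply: delta_inj; rewrite !rmorphM /=.
  have [f ->] := cent_w _ (esym xw); exact: (eps_comb_comm eps_centr f (esym yw)).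
have [C [h hP]] := commutative_subalgebra_field fieldD comV.
have h_w c : delta (h c) * w = w * delta (h c) by apply/VP/hP; exists c.
have in_h x : delta x * w = w * delta x -> exists c, x = h c by move=> xw; apply/hP/VP.
have [cg cgE] := conjugation_lrmorphism h gamma_unit.
have [s sE] : exists f' : {lrmorphism C -> C}, forall c, h (f' c) = cg c.
  apply: lrmorphism_lift => c; apply: in_h; rewrite cgE !rmorphM rmorphV //.
  exact: (symbol_conj_commute eps_centr g_unit wg (h_w c)).
have coef_indep := symbol_coef_indep fieldR eps_centr zeta'_prim q_neq0 w_neq0 g_neq0 wg.
have b_neq0 : b != 0.
  by apply: contraTneq (unitrX q w_unit) => b0; rewrite wq b0 rmorph0 unitr0.
have e_neq0 : e != 0.
  apply: contraTneq (rmorph_unit tR w_unit) => e0.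
  by rewrite /= tR_w e0 rmorph0 mul0r unitr0.
(* Applying [tR] gives commutation with [w ^+ r]. A further power [s1], inverse to [r] modulo [q],
   recovers [w] up to the central factor [b ^+ c]. *)
have tR_cent y : y * w = w * y -> tR y * w = w * tR y.
  move=> yw.
  have yw1 : tR y * w ^+ r = w ^+ r * tR y.
    have e_unit : eps e \is a GRing.unit by rewrite rmorph_unit ?unitfE.
    apply: (mulrI e_unit); rewrite mulrA eps_centr -mulrA -tR_w -rmorphM yw.
    by rewrite rmorphM /= tR_w mulrA.
  have [s1 [c sr]] := coprime_mul_inv r_gt0 co_rq.
  have b_unit : eps (b ^+ c) \is a GRing.unit.
    by rewrite rmorph_unit // unitfE expf_neq0.
  have := commrX s1 (yw1 : GRing.comm _ _).
  rewrite /GRing.comm -exprM mulnC sr exprD exprM wq expr1 -rmorphXn => E.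
  apply: (mulrI b_unit); rewrite mulrA eps_centr -mulrA E.
  by rewrite mulrA.
have h_surj x : exists c : {ffun 'I_q -> C}, x = \sum_(i < q) h (c i) * gamma ^+ i.
  have [f Dx] := symbol_coef_exists fieldR eps_centr zeta'_prim q_neq0 dimR
    w_neq0 g_neq0 wg (delta x).
  pose y j := \sum_i eps (f j i) * w ^+ i.
  have yw j : y j * w = w * y j by apply: (eps_comb_comm eps_centr).
  (* As [tR] fixes [delta x] and [g], uniqueness of the coefficients forces it to fix each of them;
     by [tR_fixed] they come from [D]. *)
  have tRy j : tR (y j) = y j.
    apply/eqP; rewrite -subr_eq0; apply/eqP.
    apply: (coef_indep (fun j => tR (y j) - y j)) => [i|].
      by rewrite mulrBr mulrBl yw tR_cent.
    under eq_bigr do rewrite mulrBl; rewrite sumrB -Dx -[delta x]tR_delta.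
    rewrite Dx rmorph_sum /=; apply/eqP; rewrite subr_eq0; apply/eqP.
    by apply: eq_bigr => j' _; rewrite rmorphM rmorphXn /= tR_delta.
  have /fin_all_exists[c cE] j : exists c, y j = delta (h c).
    have [x1 Dy] := tR_fixed (tRy j).
    have [|c Dc] := in_h x1; first by rewrite -Dy.
    by exists c; rewrite -Dc.
  exists [ffun i => c i]; apply: delta_inj; rewrite Dx rmorph_sum /=.
  by apply: eq_bigr => i _; rewrite ffunE rmorphM rmorphXn /= -cE.
have h_inj (c : {ffun 'I_q -> C}) : \sum_(i < q) h (c i) * gamma ^+ i = 0 -> c = 0.
  move=> sum0; apply/ffunP => i; rewrite ffunE; apply/eqP.
  rewrite -(fmorph_eq0 h) -(inj_eq delta_inj) rmorph0; apply/eqP.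
  apply: (coef_indep (fun i => delta (h (c i)))) => [j|]; first by rewrite h_w.
  move/(congr1 delta): sum0; rewrite rmorph0 rmorph_sum /= => {}sum0.
  rewrite -[RHS]sum0.
  by apply: eq_bigr => j _; rewrite rmorphM rmorphXn.
have s_order c : iter q s c = c.
  apply: (fmorph_inj h).
  have iterE i : h (iter i s c) = gamma ^+ i * h c * gamma ^- i.
    elim: i => [|i IHi]; first by rewrite mul1r invr1 mulr1.
    by rewrite iterS sE cgE IHi exprS invrM ?unitrX // !mulrA.
  by rewrite /= iterE gamma_q mulr_algl -mulr_algr -gamma_q mulrK ?unitrX.
(* A fixed element commutes with [C] and with [gamma], which generate [D], so it is central. *)
have s_fixed c : s c = c -> exists a' : F, c = a'%:A.
  move=> sc; have hc_gamma : h c * gamma = gamma * h c.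
    by rewrite -{1}sc sE cgE mulrVK.
  have : h c \in 'Z({:D})%VS.
    rewrite memv_cap memvf; apply/centvP => x _; have [c' ->] := h_surj x.
    rewrite mulr_suml mulr_sumr; apply: eq_bigr => i _.
    rewrite mulrA -rmorphM mulrC rmorphM -!mulrA; congr (_ * _).
    exact: commrX.
  rewrite centerD => /vlineP[a' ha']; exists a'; apply: (fmorph_inj h).
  by rewrite /= ha' linearZ /= rmorph1.
have [CS [f [sigma [f_bij galCS genCS sigmaE]]]] :=
  cyclic_field_galois q_gt0 s_order s_fixed.
pose hf : {lrmorphism CS -> D} := h \o f.
have hf_bij : bijective (cyclic_sum (m := q) hf gamma).
  apply: linear_bij; first exact: cyclic_sum_linear.
    move=> c sum0; apply/ffunP => i; rewrite ffunE; apply/eqP.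
    have /ffunP/(_ i) : [ffun i => f (c i)] = 0.
      by apply: h_inj; rewrite -[RHS]sum0; apply: eq_bigr => j _; rewrite ffunE.
    by rewrite !ffunE => /eqP; rewrite fmorph_eq0.
  move=> x; have [c ->] := h_surj x; have [f' _ f'K] := f_bij.
  by exists [ffun i => f' (c i)]; apply: eq_bigr => i _; rewrite ffunE /= f'K.
have dimCS : \dim {:CS} = q.
  have := cyclic_sum_dim hf_bij; rewrite dimD expnS expn1 => /eqP.
  by rewrite eqn_pmul2l // => /eqP.
exists CS, sigma, a, hf, gamma; rewrite /= dimCS; split=> //.
- move=> c; rewrite /= -cgE -sE sigmaE //.
Qed.

End CyclicDescent.

Theorem theorem3p6 (p n : nat) (p_prime : prime p) (p_odd : odd p)
    (n_ge1 : (1 <= n)%N)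
    (F : fieldType) (charF : p \notin [pchar F])
    (Fbar : closedFieldType) (iota : {rmorphism F -> Fbar})
    (Fbar_closure : is_algebraic_closure iota)
    (mu_p_notin_F : ~ (forall z : Fbar, mu p z -> exists a : F, z = iota a))
    (d : nat) (d_degree : degree_over iota (adjoin iota (mu (p ^ n))) d)
    (p_ndvd_d : ~~ (p %| d)%N)
    (D : falgType F) (D_central_division : is_central_division D)
    (D_degree : has_degree D (p ^ n)) :
  is_cyclic_algebra D <->
  exists (gamma : D) (a : F),
    [/\ gamma ^+ (p ^ n) = a%:A, a != 0
      & ~ exists2 c : F, c != 0 & a = c ^+ p].
Proof.
have [centerD fieldD] := D_central_division.
have p_gt1 := prime_gt1 p_prime.
have q_gt0 : (0 < p ^ n)%N by rewrite expn_gt0 prime_gt0.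
have pn : (p ^ n = p * p ^ n.-1)%N by rewrite -expnS prednK.
split=> [[C [sigma [b [h [x [_ b_neq0 xm _ bij]]]]]] | [gamma [a [gamma_q a_neq0 a_pow]]]].
  (* The cyclic algebra has dimension [\dim {:C}] squared, to be compared with the degree of [D]. *)
  have dimC : \dim {:C} = (p ^ n)%N.
    apply/eqP; rewrite -eqn_sqr -D_degree -(cyclic_sum_dim bij).
    by rewrite expnS expn1.
  exists x, b; split=> //; first by rewrite -dimC.
  case=> c _ Db; rewrite Db in xm.
  have k_gt0 : (0 < p ^ n.-1)%N by rewrite expn_gt0 prime_gt0.
  exact: (cyclic_sum_not_power fieldD bij p_gt1 k_gt0 (etrans dimC pn) xm).
have q_neq0 : (p ^ n)%:R != 0 :> F.
  by rewrite natrX expf_neq0 //; apply: contra charF => p0; rewrite inE p_prime.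
have [L [zeta [zeta_prim gen dimL]]] :=
  cyclotomic_field_presentation q_gt0 q_neq0 d_degree.
have p_ndvd_L : ~~ (p %| \dim {:L})%N by rewrite dimL.
have [t [r [[r_gt0 co_rq t_zeta td r_order] t_fixed]]] :=
  cyclotomic_extension p_prime n_ge1 zeta_prim gen p_ndvd_L.
have d_gt0 : (0 < \dim {:L})%N by rewrite adim_gt0.
have co_dq : coprime (\dim {:L}) (p ^ n).
  by rewrite coprimeXr // coprime_sym prime_coprime.
have co_dims : coprime (\dim {:L}) (\dim {:D}) by rewrite D_degree coprimeXr.
have [R [delta [eps [tR [[fieldR comm tR_delta tR_eps] [dimR genR]]]]]] :=
  base_change fieldD co_dims d_gt0 td.
rewrite D_degree in dimR.
have q_neq0L : (p ^ n)%:R != 0 :> L.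
  by rewrite -(rmorph_nat (in_alg L)) fmorph_eq0.
have eps_centr := eps_central comm genR.
have tRd := tR_order td tR_delta tR_eps genR.
have tR_fixed := tensor_fixed zeta_prim q_neq0L r_gt0 t_zeta d_gt0 td r_order
  t_fixed comm tR_delta tR_eps genR.
have gq : delta gamma ^+ (p ^ n) = a%:A.
  by rewrite -rmorphXn /= gamma_q linearZ /= rmorph1.
have g_neq0 : delta gamma != 0.
  apply: contraNneq a_neq0 => g0; move: gq; rewrite g0 expr0n gtn_eqF //=.
  by move/esym/eqP; rewrite scaler_eq0 oner_eq0 orbF.
have gq_central y : delta gamma ^+ (p ^ n) * y = y * delta gamma ^+ (p ^ n).
  by rewrite gq mulr_algl mulr_algr.
have [x gx] : exists x, gamma ^+ (p ^ n.-1) * x != x * gamma ^+ (p ^ n.-1).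
  have : ~~ ({:D} <= 'C[(gamma ^+ (p ^ n.-1))%R])%VS.
    apply/negP; rewrite subv_cent1 => cent.
    have : gamma ^+ (p ^ n.-1) \in 'Z({:D})%VS by rewrite memv_cap memvf.
    rewrite centerD => /vlineP[c Dc]; apply: a_pow.
    (* Were [gamma ^+ (p ^ n.-1)] a scalar [c], its [p]-th power would give [a = c ^+ p]. *)
    have Da : a = c ^+ p.
      have /eqP : (a - c ^+ p) *: (1 : D) = 0.
        by rewrite scalerBl -gamma_q pn mulnC exprM Dc exprZn expr1n subrr.
      by rewrite scaler_eq0 oner_eq0 orbF subr_eq0 => /eqP.
    exists c => //; apply: contraNneq a_neq0 => c0.
    by rewrite Da c0 expr0n gtn_eqF // prime_gt0.
  case/subvPn => x _ /cent1vP gx; exists x; apply/eqP => E; exact: gx (esym E).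
have delta_inj : injective delta := skew_field_rmorph_inj fieldD.
have gx_delta :
    delta gamma ^+ (p ^ n.-1) * delta x != delta x * delta gamma ^+ (p ^ n.-1).
  by rewrite -rmorphXn -!rmorphM (inj_eq delta_inj).
have [z z_neq0 gz] := eigenvector_exists fieldR eps_centr p_prime n_ge1 zeta_prim
  q_neq0L g_neq0 gq_central gx_delta.
have [w [b [e [w_neq0 gw wq tR_w]]]] := equivariant_eigenvector fieldR eps_centr
  zeta_prim q_neq0L r_gt0 t_zeta d_gt0 td r_order co_dq co_rq tR_eps tRd dimR
  g_neq0 gq (tR_delta gamma) z_neq0 gz.
exact: (cyclic_of_equivariant_eigenvector fieldD fieldR centerD eps_centr zeta_prim
  q_neq0L r_gt0 co_rq tR_delta tR_fixed D_degree dimR a_neq0 gamma_q w_neq0 gw wq tR_w).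
Qed.
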